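(* Let $k_{\max}=k_{\max}(x)$ be a positive-integer-valued function with $\log k_{\max}(x)/\log x\to 0$ as $x\to\infty$ (i.e. $k_{\max}=x^{o(1)}$). Choose $m$ uniformly at random from $\{1,\ldots,x\}$. Then \[ \lim_{x\to\infty}\mathbb{P}\big(\forall\, 8\le k\le k_{\max}:\ G_{f_{m-k,m}}=S_k\big)=1 . \]
   Context: For integers $0\le n<m$ the trimmed exponential is $f_{n,m}(x)=\sum_{j=n}^{m}\frac{x^{j-n}}{j!}\in\mathbb{Q}[x]$, a polynomial of degree $m-n$. For $g\in\mathbb{Q}[x]$ of degree $k$, $G_g$ denotes the Galois group over $\mathbb{Q}$ of the splitting field of $g$, viewed as a permutation group on the roots of $g$ (so $G_g\le S_k$). The event in the claim is understood to include the requirement $m-k\ge 0$ for all $k$ considered, so that all polynomials are defined. *)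

(* Defs.v *)
From HB Require Import structures.
From mathcomp Require Import all_boot all_order all_algebra all_field.
From mathcomp Require Import all_classical all_reals all_analysis.
Set Implicit Arguments. Unset Strict Implicit. Unset Printing Implicit Defensive.
Import Order.TTheory GRing.Theory Num.Theory.
Local Open Scope ring_scope.

Definition trexp (n m : nat) : {poly rat} :=
  \poly_(i < (m - n).+1) ((n + i)`!%:R)^-1.

Definition polyC_alg (g : {poly rat}) : {poly algC} := map_poly ratr g.

(* G_g = S_k, where k = deg g: g has k distinct roots in algC (so G_g acts
   on a k-element root set), and every permutation of that root set is
   induced by a field automorphism of Qbar = algC (equivalently, by an
   element of Gal(splitting field / Q): the restriction map
   Aut(Qbar) -> Gal(split/Q) is surjective). *)
Definition galois_group_is_full_symmetric (g : {poly rat}) : Prop :=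
  g != 0 /\
  (exists s : seq algC, [/\ uniq s, size s = (size g).-1 &
     forall z, root (polyC_alg g) z = (z \in s)]) /\
  (forall f : algC -> algC,
     {in root (polyC_alg g), forall z, root (polyC_alg g) (f z)} ->
     {in root (polyC_alg g) &, injective f} ->
     exists u : {rmorphism algC -> algC},
       {in root (polyC_alg g), forall z, u z = f z}).

Definition good_m (K m : nat) : Prop :=
  forall k : nat, (8 <= k <= K)%N ->
    (k <= m)%N /\ galois_group_is_full_symmetric (trexp (m - k) m).

Definition prob_good {R : realType} (K : nat) (x : R) : R :=
  (count (fun m => `[< good_m K m >]) (iota 1 (Num.truncn x)))%:R
    / (Num.truncn x)%:R.

(* Main.v *)
(** Up to a constant the polynomial is [g = \sum_j m (m-1) ... (m-j+1) X^(k-j)].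
    If a prime [q > k] divides [m - i] exactly once, [i < k], then [g] has
    [k - i] roots of [q]-adic valuation [1 / (k - i)], its other [i] roots are
    units with distinct residues, and its discriminant has valuation
    [k - i - 1]. Hence the inertia group fixes the latter roots and, being tame,
    permutes the former transitively. The cases [i = 0, 1] give a 2-transitive
    group containing an odd permutation; a case with [k - i = 2] or
    [8 (k - i) <= k] adds a nontrivial element of small support. Commutators
    turn such an element into a transposition or a 3-cycle, so the group is
    symmetric.

    By a second moment argument with primes between [K^2] and [K^(2 * 8^T)],
    for most [m] every dyadic block of shifts [i] contains some [i] for which
    [m - i] has such a prime divisor; the exceptional proportions for blocks of
    length [2^s] decay like [2^-s / T], and so can be summed over all blocks. *)

(* The transitivity claim rests on one fact: an element fixed by a tame inertia group has integral
   valuation at [q]. The product of the roots in an inertia orbit [B] of nonunit roots is such an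
   element and has valuation [#|B| / j] with [j = k - i]; so [j] divides [#|B|], and [B] contains
   all [j] of them. The fact itself is proved without completions or uniformisers: a suitable
   multiple of the element has a trace to the rationals with the same valuation. Tameness means that
   the order of inertia is invertible modulo [q]; this holds because that order divides [k!] and
   [q > k].

   On the probabilistic side, a prescribed shift is only shown to fail with proportion [O(1 / T)],
   where [T] is fixed before [x] grows, and this cannot be summed over all [k <= K]. The blocks do
   not depend on [k], and long blocks fail rarely; hence for large [k] the third prime is sought in
   a block close to [k] rather than at a prescribed shift. The hypothesis on [kmax] makes
   [K ^ (8 * 8 ^ T)] at most [x] for each fixed [T], which absorbs the error terms of the
   counting. *)
Require Import Defs.
From HB Require Import structures.
From mathcomp Require Import all_boot all_order all_algebra all_fingroup all_field.
From mathcomp Require Import all_classical all_reals all_analysis.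
From mathcomp Require Import zify ring lra.
Set Implicit Arguments. Unset Strict Implicit. Unset Printing Implicit Defensive.
Import Order.TTheory GRing.Theory Num.Theory numFieldNormedType.Exports.

(** * Two-transitive permutation groups *)

Section TwoTransitive.
Local Open Scope group_scope.
Variables (T : finType) (H : {group {perm T}}).

Definition supp (a : {perm T}) := [set x | a x != x].
Definition cycle3 (x y z : T) : {perm T} := tperm x y * tperm x z.

Lemma cycle3J x y z s : cycle3 x y z ^ s = cycle3 (s x) (s y) (s z).
Proof. by rewrite /cycle3 conjMg !tpermJ. Qed.

Lemma cycle3V x y z : (cycle3 x y z)^-1 = cycle3 x z y.
Proof. by rewrite /cycle3 invMg !tpermV. Qed.

Lemma cycle3E x y z : x != y -> x != z -> y != z ->
  [/\ cycle3 x y z x = y, cycle3 x y z y = z & cycle3 x y z z = x].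
Proof.
move=> xy xz yz; split; rewrite permM.
- by rewrite tpermL tpermD // eq_sym.
- by rewrite tpermR tpermL.
- by rewrite (tpermD xz yz) tpermR.
Qed.

Lemma cycle3D x y z w : w != x -> w != y -> w != z -> cycle3 x y z w = w.
Proof. by move=> xw yw zw; rewrite permM !tpermD // eq_sym. Qed.

Lemma cycle3_rot x y z : x != y -> x != z -> y != z ->
  cycle3 x y z = cycle3 y z x.
Proof.
move=> xy xz yz; have [a b c] := cycle3E xy xz yz.
have [a' b' c'] : [/\ cycle3 y z x y = z, cycle3 y z x z = x & cycle3 y z x x = y].
  by apply: cycle3E; rewrite // eq_sym.
apply/permP => w; have [->|wx] := eqVneq w x; first by rewrite a c'.
have [->|wy] := eqVneq w y; first by rewrite b a'.
have [->|wz] := eqVneq w z; first by rewrite c b'.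
by rewrite !cycle3D.
Qed.

Hypothesis H2 : forall x y x' y' : T, x != y -> x' != y' ->
  exists2 h, h \in H & h x = x' /\ h y = y'.

Lemma sym_of_tperm a b : a != b -> tperm a b \in H -> forall s, s \in H.
Proof.
move=> ab Hab; have Ht x y : x != y -> tperm x y \in H.
  move=> xy; have [h hH [<- <-]] := H2 ab xy.
  by rewrite -tpermJ groupJ.
move=> s; have [ts -> dts] := prod_tpermP s.
rewrite big_seq group_prod // => t /(allP dts).
by rewrite /perm.dpair /=; apply: Ht.
Qed.

(** Conjugating [(x y z)] by the inverse of [(x z w)] gives [(w y x)], the inverse of [(x y w)]. *)
Lemma cycle3_mem_trans x y z w : uniq [:: x; y; z; w] ->
  cycle3 x y z \in H -> cycle3 x z w \in H -> cycle3 x y w \in H.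
Proof.
rewrite /= !inE !negb_or => /and4P[/and3P[xy xz xw] /andP[yz yw] zw _] h1 h2.
have [a b c] := cycle3E xz xw zw.
have h3 := groupJ h1 (groupVr h2).
have E p q : cycle3 x z w p = q -> (cycle3 x z w)^-1 q = p.
  by move=> <-; rewrite permK.
have yfix : cycle3 x z w y = y by rewrite cycle3D // eq_sym.
move: h3; rewrite cycle3J (E _ _ a) (E w x c) (E y y yfix) => h3.
by rewrite -groupV cycle3V cycle3_rot // eq_sym.
Qed.

(** Two-transitivity puts every pair of points into some 3-cycle of [H]. These are joined until all
    3-cycles, hence all even permutations, lie in [H]; then [h] supplies the odd ones. *)
Lemma sym_of_cycle3 x y z h : x != y -> x != z -> y != z ->
  cycle3 x y z \in H -> h \in H -> odd_perm h -> forall s, s \in H.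
Proof.
move=> xy xz yz Hxyz Hh odd_h.
have ex3 a b : a != b -> exists c, [/\ a != c, b != c & cycle3 a b c \in H].
  move=> ab; have [g gH [ga gb]] := H2 xy ab.
  exists (g z); rewrite -ga -gb -cycle3J groupJ //.
  by rewrite !(inj_eq perm_inj).
have rotH a b c : a != b -> a != c -> b != c ->
    cycle3 a b c \in H -> cycle3 b c a \in H.
  by move=> ab ac bc; rewrite cycle3_rot.
have all3 a b u : a != b -> a != u -> b != u -> cycle3 a b u \in H.
  move=> ab au bu; have [c [ac bc Habc]] := ex3 _ _ ab.
  have [->//|uc] := eqVneq u c.
  (* If [(a u w)] avoids [b] and [c], it conjugates [(a b c)] to [(u b c)], and [cycle3_mem_trans]
     combines the two. *)
  have [w [aw uw Hauw]] := ex3 _ _ au.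
  have [wb|wb] := eqVneq w b.
    by rewrite -groupV cycle3V -wb.
  have [wc|wc] := eqVneq w c.
    rewrite wc in Hauw; apply: (@cycle3_mem_trans a b c u) => //.
      by rewrite /= !inE !negb_or ab ac au bc bu eq_sym uc.
    by rewrite -groupV cycle3V.
  have Hubc : cycle3 u b c \in H.
    have [e1 e2 e3] := cycle3E au aw uw.
    have eb : cycle3 a u w b = b by rewrite cycle3D // eq_sym.
    have ec : cycle3 a u w c = c by rewrite cycle3D // eq_sym.
    by rewrite -eb -ec -{1}e1 -cycle3J groupJ.
  have H1 : cycle3 b a c \in H.
    by rewrite -groupV cycle3V; apply: rotH; rewrite // eq_sym.
  have H1' : cycle3 b c u \in H by apply: rotH; rewrite // eq_sym.
  have : cycle3 b a u \in H.
    apply: (@cycle3_mem_trans b a c u) => //=.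
    by rewrite !inE !negb_or eq_sym ab ac au bc bu eq_sym uc.
  by move=> H3; rewrite -groupV cycle3V; apply: rotH; rewrite // eq_sym.
have ev a b c d : a != b -> c != d -> tperm a b * tperm c d \in H.
  have ev1 p q r : p != q -> p != r -> tperm p q * tperm p r \in H.
    move=> pq pr; have [<-|qr] := eqVneq q r; last exact: all3.
    by rewrite tperm2.
  move=> ab cd; have [ac|nac] := eqVneq a c; first by move: cd; rewrite -ac => ad; apply: ev1.
  have -> : tperm a b * tperm c d = (tperm a b * tperm a c) * (tperm c a * tperm c d).
    by rewrite (tpermC c a) -[RHS]mulgA (mulgA (tperm a c)) tperm2 mul1g.
  by rewrite groupM ?ev1 // eq_sym.
(* For an odd word the induction carries the product with one more arbitrary transposition, so that
   transpositions are consumed in pairs. *)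
have par ts : all perm.dpair ts -> let p := (\prod_(t <- ts) tperm t.1 t.2)%g in
    if odd (size ts) then forall a b : T, a != b -> tperm a b * p \in H else p \in H.
  elim: ts => [|[c d] ts IH] /=; first by rewrite big_nil.
  move=> /andP[cd /IH]; rewrite big_cons /=; case: (odd (size ts)) => /= {}IH.
    exact: IH.
  by move=> a b ab; rewrite mulgA groupM ?ev.
have [ts hE dts] := prod_tpermP h.
have := par _ dts; rewrite /= -hE -(odd_perm_prod dts) -hE odd_h => /(_ _ _ xy).
by rewrite groupMr // => /(sym_of_tperm xy).
Qed.

(** Multiply on the left and right by elements of [H] that fix [x0] and carry [x'] to [x],
    respectively [y] to [y']. Used in both directions this gives equality. *)
Lemma card_fix_map x0 x y x' y' : x0 != x -> x0 != y -> x0 != x' -> x0 != y' ->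
  (#|[set h in H | (h x0 == x0) && (h x == y)]| <=
   #|[set h in H | (h x0 == x0) && (h x' == y')]|)%N.
Proof.
move=> nx ny nx' ny'.
have [u uH [u0 u1]] := H2 nx' nx; have [v vH [v0 v1]] := H2 ny ny'.
rewrite -(card_imset _ (can_inj (fun h => mulKg u h))).
rewrite -(card_imset _ (can_inj (fun h => mulgK v h))).
apply/subset_leq_card/fintype.subsetP => _ /imsetP[_ /imsetP[h + ->] ->].
rewrite !inE => /and3P[hH /eqP h0 /eqP h1].
by rewrite !groupM //= !permM u0 u1 h0 h1 v0 v1 !eqxx.
Qed.

(* Averaging over the stabiliser of [x0]: a random [h] maps a given point
   to each of the [n - 1] points other than [x0] with the same probability. *)
Lemma small_intersection (S : {set T}) x0 y0 : x0 \in S -> y0 \in S -> x0 != y0 ->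
  (#|S| < #|T|)%N ->
  exists h, [/\ h \in H, h x0 = x0, h y0 \notin S &
    (#|[set x in S :\ x0 | h x \in S]| * (#|T| - #|S|) <= (#|S|.-1) ^ 2)%N].
Proof.
move=> x0S y0S n0 ltS.
pose K x y := [set h in H | (h x0 == x0) && (h x == y)].
pose c := #|K y0 y0|.
have cE x y : x0 != x -> x0 != y -> #|K x y| = c.
  by move=> nx ny; apply/eqP; rewrite eqn_leq !card_fix_map.
have c0 : (0 < c)%N by apply/card_gt0P; exists 1; rewrite inE group1 !perm1 !eqxx.
pose G0 := [set h in H | (h x0 == x0) && (h y0 \notin S)].
have G0E : #|G0| = ((#|T| - #|S|) * c)%N.
  have <- : #|~: S| = (#|T| - #|S|)%N by rewrite cardsCs finset.setCK.
  rewrite -sum1_card (partition_big (fun h : {perm T} => h y0) (mem (~: S))) /=.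
    rewrite -sum_nat_const; apply: eq_bigr => y; rewrite inE => yS.
    rewrite -(cE y0 y) ?sum1_card //; last by apply: contraNneq yS => <-.
    apply: eq_card => h; rewrite -topredE /= !inE.
    by case: (h y0 =P y) => [->|_]; rewrite ?andbF // yS !andbT.
  by move=> h; rewrite !inE => /and3P[].
set N := (#|T| - #|S|)%N in G0E *.
have N0 : (0 < N)%N by rewrite subn_gt0.
pose I h := [set x in S :\ x0 | h x \in S].
suff [h hG Ih] : exists2 h, h \in G0 & (#|I h| * N <= #|S|.-1 ^ 2)%N.
  by exists h; move: hG; rewrite inE => /and3P[-> /eqP-> ->].
apply/exists_inP; apply: contraT; rewrite negb_exists_in => /forall_inP bad.
have S1 : #|S :\ x0| = #|S|.-1 by rewrite (cardsD1 x0 S) x0S.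
(* The upper bound forgets the condition on [y0] and sums over the whole stabiliser of [x0]. *)
have sumI : (\sum_(h in G0) #|I h| <= #|S|.-1 ^ 2 * c)%N.
  apply: (@leq_trans (\sum_(h in G0) \sum_(x in S :\ x0) \sum_(y in S :\ x0) (h x == y))).
    apply: leq_sum => h; rewrite inE => /and3P[_ /eqP h0 _].
    rewrite -sum1_card (eq_bigl (fun x => (x \in S :\ x0) && (h x \in S))); last first.
      by move=> x; rewrite !inE.
    rewrite big_mkcondr /=; apply: leq_sum => x xS.
    case: ifP => // hxS; rewrite (bigD1 (h x)) /= ?eqxx // !inE hxS andbT.
    by rewrite -[X in _ != X]h0 (inj_eq perm_inj); move: xS; rewrite !inE => /andP[].
  rewrite exchange_big /= -S1 -mulnn -mulnA -sum_nat_const.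
  apply: leq_sum => x xS; rewrite exchange_big -sum_nat_const /=.
  apply: leq_sum => y yS; rewrite -big_mkcondr /= sum1_card.
  move: xS yS; rewrite !inE ![_ == x0]eq_sym => /andP[nx _] /andP[ny _].
  rewrite -(cE _ _ nx ny); apply/subset_leq_card/fintype.subsetP => h.
  by rewrite -topredE /= !inE => /andP[/and3P[-> -> _] ->].
have : (\sum_(h in G0) (#|S|.-1 ^ 2).+1 <= \sum_(h in G0) #|I h| * N)%N.
  by apply: leq_sum => h /bad; rewrite -ltnNge.
rewrite sum_nat_const G0E -big_distrl /= => le1.
have := leq_trans le1 (leq_mul sumI (leqnn N)).
by rewrite -[(_ * c * N)%N]mulnA (mulnC c) mulnC leq_pmul2r ?muln_gt0 ?N0 ?ltnn.
Qed.

(** If [a] moves [x] while [b] fixes both [x] and [a^-1 x], the commutator fixes [x], and likewise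
    with [a] and [b] exchanged. The use of this is a bound by three times the size of the common
    support. *)
Lemma supp_commg (a b : {perm T}) :
  supp [~ a, b] \subset (supp a :&: supp b) :|: a @: (supp a :&: supp b)
                                          :|: b @: (supp a :&: supp b).
Proof.
have suppV (c : {perm T}) y : c^-1 y = y <-> c y = y.
  by split=> e; rewrite -[in LHS]e ?permK ?permKV.
have memJ (c : {perm T}) (A : {set T}) y : (y \in c @: A) = (c^-1 y \in A).
  by rewrite -[in LHS](permKV c y) mem_imset //; apply: perm_inj.
apply/fintype.subsetP => x; rewrite !finset.in_setU !memJ !inE commgEl conjgE !permM.
apply: contraNT; rewrite !negb_or !negb_and !negbK => /andP[/andP[h1 h2] h3].
have suppVE (c : {perm T}) y : (c (c^-1 y) == c^-1 y) = (c y == y).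
  by rewrite permKV eq_sym; apply/eqP/eqP => /suppV.
move: h2 h3; rewrite !suppVE; case: (a x =P x) h1 => [ax _ _|ax /= bx].
  move/(suppV a): (ax) => ->; case/orP => [/eqP aw|/eqP bx].
    by rewrite aw permKV.
  by move/suppV: (bx) => ->; rewrite ax bx.
by move=> /eqP bw _; move/suppV: (bw) => ->; rewrite permKV.
Qed.

(* An element of minimal support moves at most three points: otherwise its
   commutator with a conjugate meeting it in few points has smaller support. *)
Theorem sym_of_small_support a h : a \in H -> a != 1 ->
  (#|supp a| <= 2)%N || (8 * #|supp a| <= #|T|)%N ->
  h \in H -> odd_perm h -> forall s, s \in H.
Proof.
move=> aH a1 sa hH odd_h.
pose Q (b : {perm T}) := [&& b \in H, b != 1 &
  (#|supp b| <= 2)%N || (8 * #|supp b| <= #|T|)%N].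
have Qa : Q a by apply/and3P.
have [b /and3P[bH b1 sb] bmin] := arg_minnP (fun b => #|supp b|) Qa.
have [x0 bx0] : exists x, b x != x.
  apply/existsP; apply: contraT; rewrite negb_exists => /forallP hb.
  by case/eqP: b1; apply/permP => x; rewrite perm1; apply/eqP; rewrite -[_ == _]negbK hb.
have x0S : x0 \in supp b by rewrite inE.
have y0S : b x0 \in supp b by rewrite inE (inj_eq perm_inj).
have [s3|s4] := leqP #|supp b| 3; last first.
  have s8 : (8 * #|supp b| <= #|T|)%N.
    by case/orP: sb => // s2; move: (leq_trans s4 s2).
  have [||g [gH g0 gy cI]] := small_intersection x0S y0S; [by rewrite eq_sym| |].
    by move: s8 s4; clear; lia.
  set J := [set x in supp b :\ x0 | g x \in supp b] in cI.
  have suppJ : supp (b ^ g) = g @: supp b.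
    apply/setP => x; rewrite -[x in LHS](permKV g) -[x in RHS](permKV g).
    by rewrite mem_imset ?inE ?permJ ?(inj_eq perm_inj) //; apply: perm_inj.
  have cardI : #|supp b :&: supp (b ^ g)| = #|J|.+1.
    have <- : #|x0 |: J| = #|J|.+1 by rewrite cardsU1 !inE eqxx.
    rewrite -(card_imset (x0 |: J) (@perm_inj _ g)) suppJ.
    suff -> : g @: (x0 |: J) = supp b :&: g @: supp b by [].
    apply/setP => y; rewrite -[y](permKV g); move: (g^-1 y) => {}y.
    rewrite finset.in_setI !mem_imset; try exact: perm_inj.
    rewrite !inE; case: eqVneq => /= [->|_]; last by rewrite andbC.
    by rewrite g0 andbb; move: x0S; rewrite inE.
  have := subset_leq_card (supp_commg b (b ^ g)).
  have cU (A B : {set T}) : (#|A :|: B| <= #|A| + #|B|)%N.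
    by rewrite cardsU leq_subr.
  move=> /leq_trans/(_ (cU _ _)); move/leq_trans/(_ (leq_add (cU _ _) (leqnn _))).
  rewrite !card_imset; try exact: perm_inj.
  rewrite cardI; set r := [~ b, _] => le_r.
  have rH : r \in H by rewrite groupR ?groupJ.
  (* [b ^ g] takes [x0] to [g (b x0)], a point fixed by [b]; if the two commuted, [b ^ g] would take
     [b x0] to that same point. *)
  have r1 : r != 1.
    apply: contra gy => /commgP cab; have := congr1 (fun s : {perm T} => s x0) cab.
    have bg : (b ^ g) x0 = g (b x0) by rewrite -{1}g0 permJ.
    rewrite /= permM [RHS]permM bg => E; rewrite inE; apply: contraT; rewrite negbK => /eqP bgb.
    have : (b ^ g) (b x0) = (b ^ g) x0 by rewrite E bgb bg.
    by move/perm_inj/eqP; rewrite (negPf bx0).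
  have leb : (#|supp b| <= #|supp r|)%N.
    have [small|/ltnW//] := leqP #|supp r| #|supp b|.
    apply: bmin; rewrite /Q rH r1; apply/orP; right.
    by apply: leq_trans s8; rewrite leq_mul2l.
  exfalso; move: (leq_trans leb le_r) cI s8 s4.
  (* The inequalities [t <= 3 * (c + 1)], [c * (n - t) <= (t - 1) ^ 2] and [8 * t <= n] give
     [7 * t * (t - 3) <= 3 * (t - 1) ^ 2], which is false from [t = 4] on. *)
  move: #|J| #|supp b| #|T| => c t n; clear; case: t => [|[|[|[|t]]]] // l1 l2 l3 _.
  have l4 : (7 * t.+4 <= n - t.+4)%N by lia.
  have {l2 l3 l4} l2 := leq_trans (leq_mul (leqnn c) l4) l2.
  have {}l1 : (t.+1 <= 3 * c)%N by lia.
  have := leq_mul l1 (leqnn (7 * t.+4)).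
  by move: l2; rewrite -mulnn /=; clear; lia.
set y0 := b x0 in y0S.
have sub3 (A : {set T}) : A \subset supp b -> (3 <= #|A|)%N -> A = supp b.
  by move=> As A3; apply/eqP; rewrite eqEcard As (leq_trans s3).
have [e|ne] := eqVneq (b y0) x0.
  apply: (@sym_of_tperm x0 y0); first by rewrite eq_sym.
  suff <- : b = tperm x0 y0 by [].
  apply/permP => w; case: tpermP => [->|->|/eqP nx /eqP ny] //.
  apply/eqP; apply: contraT => bw.
  have : (#|[set x0; y0; w; b w]| <= #|supp b|)%N.
    apply/subset_leq_card/fintype.subsetP => v; rewrite !inE.
    by case/orP => [/orP[/orP[]|]|] /eqP->; rewrite ?(inj_eq perm_inj).
  rewrite -!finset.setUA !cardsU1 cards1 !inE.
  rewrite ![_ == b w]eq_sym -[X in b w == X]e (inj_eq perm_inj) (inj_eq perm_inj) /=.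
  rewrite (negPf bw) [x0 == _]eq_sym (negPf bx0) ![_ == w]eq_sym.
  by rewrite (negPf nx) (negPf ny) => /leq_trans/(_ s3).
have bz : b y0 != y0 by rewrite inE in y0S.
apply: (@sym_of_cycle3 x0 y0 (b y0) h); rewrite // 1?eq_sym //.
suff <- : b = cycle3 x0 y0 (b y0) by [].
have S3 : [set x0; y0; b y0] = supp b.
  apply: sub3; first by apply/fintype.subsetP => v; rewrite !inE => /orP[/orP[]|] /eqP->; rewrite ?(inj_eq perm_inj).
  rewrite -!finset.setUA !cardsU1 cards1 !inE.
  by rewrite ![_ == b y0]eq_sym (negPf ne) (negPf bz) eq_sym (negPf bx0).
have [|||e1 e2 e3] := @cycle3E x0 y0 (b y0); rewrite // 1?eq_sym //.
have bbb : b (b y0) = x0.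
  have : b (b y0) \in supp b by rewrite inE !(inj_eq perm_inj).
  rewrite -S3 !inE => /orP[/orP[/eqP//|/eqP/perm_inj e]|/eqP/perm_inj e].
    by rewrite e eqxx in ne.
  by rewrite e eqxx in bz.
apply/permP => w; have [->|wx] := eqVneq w x0; first by rewrite e1.
have [->|wy] := eqVneq w y0; first by rewrite e2.
have [->|wz] := eqVneq w (b y0); first by rewrite e3.
rewrite cycle3D //; apply/eqP; apply: contraT => bw.
have : w \in supp b by rewrite inE.
by rewrite -S3 !inE (negPf wx) (negPf wy) (negPf wz).
Qed.
End TwoTransitive.

(** * Trimmed exponentials *)

Lemma prime_dvd_fact p n : prime p -> p %| n`! -> p <= n.
Proof.
move=> pr; elim: n => [|n IH]; first by rewrite dvdn1 => /eqP p1; rewrite p1 in pr.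
by rewrite factS Euclid_dvdM // => /orP[/dvdn_leq->//|/IH/leqW].
Qed.

Lemma subn_subl m a b : (a <= b)%N -> (b <= m)%N -> (m - a - (m - b) = b - a)%N.
Proof. lia. Qed.

Section FallingFactorial.
Variables (q m k i0 : nat).
Hypotheses (q_prime : prime q) (kq : (k < q)%N) (i0k : (i0 < k)%N) (km : (k <= m)%N).
Hypothesis q_val : logn q (m - i0) = 1%N.

(** Two multiples of [q] among the [m - i] with [i < k] would differ by less than [k < q]. *)
Lemma dvdn_sub_shift i : (i < k)%N -> (q %| m - i)%N = (i == i0).
Proof.
have q0 : (q %| m - i0)%N.
  have : (0 < logn q (m - i0))%N by rewrite q_val.
  by rewrite logn_gt0 mem_primes => /and3P[].
move=> ik; apply/idP/eqP => [qi|->//].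
have H a b : (a < b)%N -> (b < k)%N -> (q %| m - a)%N -> (q %| m - b)%N -> False.
  move=> ab bk qa qb; have : (q %| (m - a) - (m - b))%N by rewrite dvdn_sub.
  rewrite subn_subl 1?ltnW ?(leq_trans bk) // => /dvdn_leq; rewrite subn_gt0 ab => /(_ isT).
  by rewrite leqNgt (leq_ltn_trans (leq_subr _ _)) // (ltn_trans bk).
by case: (ltngtP i i0) => // lt; case: (H _ _ lt).
Qed.

Lemma dvdn_ffact n : (n <= k)%N -> (q %| m ^_ n)%N = (i0 < n)%N.
Proof.
elim: n => [|n IH] nk; first by rewrite ffactn0 dvdn1; case: eqP q_prime => // ->.
rewrite ffactnSr Euclid_dvdM // IH ?dvdn_sub_shift //; last exact: ltnW.
by rewrite ltnS [RHS]leq_eqVlt orbC eq_sym.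
Qed.

Lemma ffact_prime_part : exists2 b, m ^_ k = (q * b)%N & ~~ (q %| b)%N.
Proof.
have H n : (n <= k)%N -> logn q (m ^_ n) = (i0 < n)%N.
  elim: n => [|n IH] nk; first by rewrite ffactn0 logn1.
  rewrite ffactnSr lognM ?ffact_gt0 ?subn_gt0 ?(leq_trans _ km) //; last exact: ltnW.
  rewrite IH ?(ltnW nk) // ltnS.
  have [->|ne] := eqVneq n i0; first by rewrite q_val ltnn leqnn.
  rewrite [logn q (m - n)]lognE; case: and3P => [[_ _]|_].
    by rewrite dvdn_sub_shift // (negPf ne).
  by rewrite addn0 [in RHS]leq_eqVlt eq_sym (negPf ne).
have mk0 : (0 < m ^_ k)%N by rewrite ffact_gt0.
have lk := H k (leqnn k); rewrite i0k /= in lk.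
have qd : (q ^ 1 %| m ^_ k)%N by rewrite pfactor_dvdn // lk.
have qd2 : ~~ (q ^ 2 %| m ^_ k)%N by rewrite pfactor_dvdn // lk.
rewrite expn1 in qd; exists (m ^_ k %/ q); first by rewrite mulnC divnK.
apply: contra qd2 => qb; rewrite -(divnK qd) mulnC expnS expn1.
by rewrite dvdn_pmul2l ?prime_gt0.
Qed.

(** [m - k] is at distance [k - i0 < q] from the multiple [m - i0] of [q]. It is a factor of the
    constant in [trimmed_deriv], which must have valuation exactly 1. *)
Lemma not_dvdn_sub_degree : ~~ (q %| m - k)%N.
Proof.
have q0 : (q %| m - i0)%N by rewrite dvdn_sub_shift.
apply/negP => qk; have : (q %| (m - i0) - (m - k))%N by rewrite dvdn_sub.
rewrite subn_subl ?(ltnW i0k) // => /dvdn_leq; rewrite subn_gt0 i0k => /(_ isT).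
by rewrite leqNgt (leq_ltn_trans (leq_subr _ _)).
Qed.
End FallingFactorial.

Section TrimmedPoly.
Local Open Scope ring_scope.

Lemma deriv_prod_XsubC (R : idomainType) k (r : 'I_k -> R) i :
  (\prod_i ('X - (r i)%:P))^`().[r i] = \prod_(i' | i' != i) (r i - r i').
Proof.
rewrite (bigD1 i) //= derivM derivXsubC mul1r hornerD hornerM hornerXsubC.
rewrite subrr mul0r addr0 horner_prod; apply: eq_bigr => i' _.
by rewrite hornerXsubC.
Qed.

Variable (R : comNzRingType).
(** This is [m!] times [trexp (m - k) m], over any ring so that its integer, number field and [algC]
    versions map to each other. *)
Definition trimmed (m k : nat) : {poly R} := \poly_(l < k.+1) (m ^_ (k - l))%:R.

Lemma size_trimmed m k : size (trimmed m k) = k.+1.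
Proof. by rewrite size_poly_eq // subnn ffactn0 oner_eq0. Qed.

Lemma trimmed_monic m k : trimmed m k \is monic.
Proof. by rewrite monicE lead_coefE size_trimmed coef_poly ltnSn subnn ffactn0. Qed.

Lemma horner_trimmed m k z : (trimmed m k).[z] = \sum_(l < k.+1) (m ^_ (k - l))%:R * z ^+ l.
Proof. by rewrite horner_poly. Qed.

(** The recursion of the falling factorials amounts to the differential equation [X g' = X (g - X^k)
    - (m - k) (g - m ^_ k)], evaluated here at a root. It yields the valuation of the discriminant
    without computing the discriminant. *)
Lemma trimmed_deriv m k z : (k <= m)%N -> root (trimmed m k) z ->
  z * (trimmed m k)^`().[z] = (m - k)%:R * (m ^_ k)%:R - z ^+ k.+1.
Proof.
move=> km /eqP; rewrite horner_trimmed => z0.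
have -> : z * (trimmed m k)^`().[z] = \sum_(l < k.+1) (l * m ^_ (k - l))%:R * z ^+ l.
  rewrite /trimmed poly_def linear_sum /= horner_sum mulr_sumr; apply: eq_bigr => l _.
  rewrite derivZ derivXn hornerZ hornerMn hornerXn mulnC natrM.
  case: (val l) => [|n]; first by rewrite mulr0n !mulr0 mul0r.
  by rewrite -mulr_natl /= exprS; ring.
rewrite big_ord_recl mul0n mul0r add0r.
have E (l : 'I_k) : (bump 0 l * m ^_ (k - bump 0 l))%:R * z ^+ bump 0 l =
    z * ((m ^_ (k - l))%:R * z ^+ l) -
    (m - k)%:R * ((m ^_ (k - bump 0 l))%:R * z ^+ bump 0 l) :> R.
  rewrite /bump leq0n add1n.
  have -> : (k - l = (k - l.+1).+1)%N by have := ltn_ord l; lia.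
  have {1}-> : l.+1 = (m - (k - l.+1) - (m - k))%N by have := ltn_ord l; lia.
  rewrite ffactnSr exprS !natrM natrB ?natrM; first by ring.
  by have := ltn_ord l; lia.
under eq_bigr do rewrite E.
rewrite sumrB -!mulr_sumr.
have z1 := z0; rewrite big_ord_recr /= subnn ffactn0 mul1r in z0.
rewrite big_ord_recl /= subn0 expr0 mulr1 in z1.
move/eqP: z0; rewrite addr_eq0 => /eqP ->.
move/eqP: z1; rewrite addrC addr_eq0 => /eqP ->.
by rewrite exprS; ring.
Qed.
End TrimmedPoly.

(** * Inertia groups *)

Section Localisation.
Local Open Scope ring_scope.
Variables (L : fieldType) (A : subringClosed L) (P : zmodClosed L).
Hypothesis PA : {subset P <= A}.
Hypothesis PM : {in A & P, forall a x, a * x \in P}.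
Hypothesis P1 : 1 \notin P.
Hypothesis Pprime : {in A &, forall a b, a * b \in P -> (a \in P) || (b \in P)}.
Hypothesis Aroot : forall n x, (0 < n)%N -> x ^+ n \in A -> x \in A.

(* [loc_ring], [loc_max] and [loc_unit] are the localisation of [A] at [P],
   its maximal ideal and its unit group. *)
Definition loc_ring (x : L) := exists a b, [/\ a \in A, b \in A, b \notin P & x * b = a].
Definition loc_max (x : L) := exists a b, [/\ a \in P, b \in A, b \notin P & x * b = a].
Definition loc_unit (x : L) :=
  exists a b, [/\ a \in A, b \in A, a \notin P, b \notin P & x * b = a].
Local Notation O := loc_ring.
Local Notation M := loc_max.
Local Notation U := loc_unit.

Lemma notP_mul a b : a \in A -> b \in A -> a \notin P -> b \notin P -> a * b \notin P.
Proof. by move=> aA bA aP bP; apply/negP => /(Pprime aA bA); rewrite (negPf aP) (negPf bP). Qed.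

Lemma notP_exp a n : a \in A -> a \notin P -> a ^+ n \notin P.
Proof.
move=> aA aP; elim: n => [|n IH]; first by rewrite expr0.
by rewrite exprS notP_mul ?rpredX.
Qed.

Lemma notP_prod (I : Type) (r : seq I) (Q : pred I) (F : I -> L) :
  (forall i, Q i -> F i \in A /\ F i \notin P) ->
  \prod_(i <- r | Q i) F i \in A /\ \prod_(i <- r | Q i) F i \notin P.
Proof.
move=> FQ; apply: (big_ind (fun x => x \in A /\ x \notin P)) => //.
  by rewrite rpred1.
by move=> x y [xA xP] [yA yP]; rewrite rpredM ?notP_mul.
Qed.

Lemma notP_neq0 a : a \notin P -> a != 0.
Proof. by apply: contraNneq => ->; rewrite rpred0. Qed.

Lemma loc_ringA x : x \in A -> O x.
Proof. by move=> xA; exists x, 1; rewrite rpred1 mulr1. Qed.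

Lemma loc_maxP x : x \in P -> M x.
Proof. by move=> xP; exists x, 1; rewrite rpred1 mulr1. Qed.

Lemma loc_unitA x : x \in A -> x \notin P -> U x.
Proof. by move=> xA xP; exists x, 1; rewrite rpred1 mulr1. Qed.

Lemma loc_unitW x : U x -> O x.
Proof. by case=> a [b [aA bA aP bP e]]; exists a, b. Qed.

Lemma loc_maxW x : M x -> O x.
Proof. by case=> a [b [aP bA bP e]]; exists a, b; rewrite PA. Qed.

Lemma loc_unit_neq0 x : U x -> x != 0.
Proof.
case=> a [b [_ _ aP _ e]]; apply: contraNneq aP => x0.
by rewrite -e x0 mul0r rpred0.
Qed.

Lemma loc_unitV x : U x -> U x^-1.
Proof.
move=> Ux; have x0 := loc_unit_neq0 Ux; case: Ux => a [b [aA bA aP bP e]].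
by exists b, a; split; rewrite // -[in LHS]e mulKf.
Qed.

Lemma loc_unit1 : U 1.
Proof. by apply: loc_unitA; rewrite ?rpred1. Qed.

Lemma loc_unitM x y : U x -> U y -> U (x * y).
Proof.
move=> [a [b [aA bA aP bP e]]] [c [d [cA dA cP dP f]]].
by exists (a * c), (b * d); rewrite !rpredM ?notP_mul // mulrACA e f.
Qed.

Lemma loc_unitX x n : U x -> U (x ^+ n).
Proof. by move=> Ux; elim: n => [|n IH]; [exact: loc_unit1|rewrite exprS; apply: loc_unitM]. Qed.

Lemma loc_unit_prod (I : Type) (r : seq I) (Q : pred I) (F : I -> L) :
  (forall i, Q i -> U (F i)) -> U (\prod_(i <- r | Q i) F i).
Proof. by move=> FU; apply: big_ind => //; [exact: loc_unit1|exact: loc_unitM]. Qed.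

Lemma loc_ringM x y : O x -> O y -> O (x * y).
Proof.
move=> [a [b [aA bA bP e]]] [c [d [cA dA dP f]]].
by exists (a * c), (b * d); rewrite !rpredM ?notP_mul // mulrACA e f.
Qed.

Lemma loc_ringB x y : O x -> O y -> O (x - y).
Proof.
move=> [a [b [aA bA bP e]]] [c [d [cA dA dP f]]].
exists (a * d - c * b), (b * d); rewrite rpredB ?rpredM ?notP_mul //; split=> //.
by rewrite -e -f mulrBl mulrA; congr (_ - _); rewrite mulrAC mulrA.
Qed.

Lemma loc_maxM x y : O x -> M y -> M (x * y).
Proof.
move=> [a [b [aA bA bP e]]] [c [d [cA dA dP f]]].
exists (a * c), (b * d).
by split; [exact: PM|exact: rpredM|exact: notP_mul|rewrite mulrACA e f].
Qed.

Lemma loc_maxB x y : M x -> M y -> M (x - y).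
Proof.
move=> [a [b [aA bA bP e]]] [c [d [cA dA dP f]]].
exists (a * d - c * b), (b * d); split; [|exact: rpredM|exact: notP_mul|].
  by rewrite [a * d]mulrC [c * b]mulrC rpredB // PM.
by rewrite -e -f mulrBl mulrA; congr (_ - _); rewrite mulrAC mulrA.
Qed.

Lemma loc_max0 : M 0.
Proof. by apply: loc_maxP; rewrite rpred0. Qed.

Lemma loc_maxD x y : M x -> M y -> M (x + y).
Proof. by move=> Mx My; rewrite -[y]opprK -[- y]sub0r; do 2?[apply: loc_maxB => //]; exact: loc_max0. Qed.

Lemma loc_max_sum (I : Type) (r : seq I) (Q : pred I) (F : I -> L) :
  (forall i, Q i -> M (F i)) -> M (\sum_(i <- r | Q i) F i).
Proof. by move=> FM; apply: big_ind => //; [exact: loc_max0|exact: loc_maxD]. Qed.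

Lemma loc_ring_sum (I : Type) (r : seq I) (Q : pred I) (F : I -> L) :
  (forall i, Q i -> O (F i)) -> O (\sum_(i <- r | Q i) F i).
Proof.
move=> FO; apply: big_ind => //; first by apply: loc_ringA; rewrite rpred0.
move=> x y Ox Oy; rewrite -[y]opprK -[- y]sub0r; do 2?[apply: loc_ringB => //].
by apply: loc_ringA; rewrite rpred0.
Qed.

Lemma loc_max_notunit x : M x -> ~ U x.
Proof.
move=> [a [b [aP bA bP e]]] [c [d [cA dA cP dP f]]].
have : c * b \in P by rewrite -f mulrAC e mulrC PM.
by move/(Pprime cA bA); rewrite (negPf cP) (negPf bP).
Qed.

Lemma loc_ring_cases x : O x -> U x \/ M x.
Proof.
move=> [a [b [aA bA bP e]]]; case aP: (a \in P); first by right; exists a, b.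
by left; exists a, b; rewrite aP.
Qed.

Lemma loc_unitD x y : U x -> M y -> U (x + y).
Proof.
move=> Ux My; have [|//|Mxy] := @loc_ring_cases (x + y).
  rewrite -[y]opprK -[- y]sub0r; apply: loc_ringB; first exact: loc_unitW.
  by apply: loc_ringB; [apply: loc_ringA; rewrite rpred0|apply: loc_maxW].
by case: (@loc_max_notunit x) => //; rewrite -[x](addrK y); apply: loc_maxB.
Qed.

Lemma loc_max_exp x n : (0 < n)%N -> M x -> M (x ^+ n).
Proof.
case: n => // n _ Mx; elim: n => [|n IH]; first by rewrite expr1.
by rewrite exprS; apply: loc_maxM => //; apply: loc_maxW.
Qed.

(** If [x ^+ n * b = a], then [x * b] has its [n]-th power in [A]. This is the form in which
    integral closedness of [A] is used. *)
Lemma loc_ring_root x n : (0 < n)%N -> O (x ^+ n) -> O x.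
Proof.
move=> n0 [a [b [aA bA bP e]]]; exists (x * b), b; split=> //.
apply: (Aroot n0); rewrite exprMn -(prednK n0) [b ^+ _]exprS mulrA (prednK n0) e.
by rewrite rpredM ?rpredX.
Qed.

Variable p : L.
Hypothesis pP : p \in P.
Hypothesis p0 : p != 0.

(** Valuations are encoded by powers: that [x ^+ j / p ^+ b] is a unit says that [x] has valuation
    [b / j], with [p] of valuation 1. This lemma makes such exponents comparable. *)
Lemma loc_unit_expp a b u : U u -> p ^+ a = p ^+ b * u -> a = b.
Proof.
have H c d v : U v -> p ^+ c = p ^+ d * v -> (d <= c)%N -> c = d.
  move=> Uv e le; apply/eqP; rewrite eqn_leq le andbT leqNgt; apply/negP => lt.
  have : v = p ^+ (c - d).
    by apply: (mulfI (expf_neq0 d p0)); rewrite -e -exprD subnKC.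
  move=> ev; apply: (@loc_max_notunit v) => //; rewrite ev.
  by apply: loc_max_exp; rewrite ?subn_gt0 //; apply: loc_maxP.
move=> Uu e; case: (leqP b a) => [|/ltnW]; first exact: H e.
move=> /(H b a u^-1 (loc_unitV Uu)) ->//.
by rewrite e mulfK // loc_unit_neq0.
Qed.

Lemma expp_unit_prod (I : finType) (Q : pred I) (F : I -> L) j :
  (forall i, Q i -> U (F i ^+ j / p)) ->
  U ((\prod_(i | Q i) F i) ^+ j / p ^+ #|Q|).
Proof.
move=> FU; rewrite -prodrXl -prodr_const -prodf_div.
exact: loc_unit_prod.
Qed.

(** * Valuations of the roots of [trimmed] and of its derivative there *)

Section TrimmedRoots.
Variables (q m k i0 : nat).
Hypotheses (q_prime : prime q) (kq : (k < q)%N) (i0k : (i0 < k)%N) (km : (k <= m)%N).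
Hypothesis q_val : logn q (m - i0) = 1%N.
Hypothesis pE : p = q%:R.
Hypothesis notdvd : forall n, ~~ (q %| n)%N -> n%:R \notin P.
Local Notation G := (trimmed L m k).
Local Notation j := (k - i0)%N.

Let natA n : (n%:R : L) \in A. Proof. exact: rpred_nat. Qed.

Let j0 : (0 < j)%N. Proof. by rewrite subn_gt0. Qed.

(** The Newton polygon by hand: split the equation at degree [j]. The coefficients below are
    divisible by [q], the constant one exactly once, and the coefficient of degree [j] is prime to
    [q]. Hence [z ^+ j * w = - (p * v)] with units [v], [w]. *)
Lemma trimmed_root_val z : z \in P -> root G z -> U (z ^+ j / p).
Proof.
move=> zP /eqP; rewrite horner_trimmed => z0; have zA := PA zP.
have jk : (j <= k)%N by apply: leq_subr.
have expP n : (0 < n)%N -> z ^+ n \in P.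
  by case: n => // n _; rewrite exprSr PM // rpredX.
have low l : (l < j)%N -> (q %| m ^_ (k - l))%N.
  by move=> lj; rewrite (dvdn_ffact q_prime kq i0k km q_val) ?leq_subr //; lia.
pose v := \sum_(l < j) (m ^_ (k - l) %/ q)%:R * z ^+ l.
pose w := \sum_(l < k.+1 - j) (m ^_ (k - (l + j)))%:R * z ^+ l.
have Uv : U v.
  rewrite /v -(prednK j0) big_ord_recl expr0 mulr1 subn0.
  apply: loc_unitD.
    apply: loc_unitA => //; apply: notdvd.
    have [b mE qb] := ffact_prime_part q_prime kq i0k km q_val.
    by rewrite mE mulKn ?prime_gt0.
  apply: loc_max_sum => l _; apply: loc_maxM; first exact/loc_ringA.
  exact/loc_maxP/expP.
have Uw : U w.
  rewrite /w subSn // big_ord_recl expr0 mulr1 add0n.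
  apply: loc_unitD.
    apply: loc_unitA => //; apply: notdvd.
    rewrite (dvdn_ffact q_prime kq i0k km q_val) ?leq_subr //; lia.
  apply: loc_max_sum => l _; apply: loc_maxM; first exact/loc_ringA.
  exact/loc_maxP/expP.
have E : z ^+ j * w = - (p * v).
  apply/eqP; rewrite -addr_eq0 -z0; apply/eqP.
  rewrite -[in RHS](subnK (leqW jk)) addnC big_split_ord /= [LHS]addrC; congr (_ + _).
    rewrite /v mulr_sumr; apply: eq_bigr => l _.
    by rewrite mulrA pE -natrM mulnC divnK ?low.
  rewrite /w mulr_sumr; apply: eq_bigr => l _.
  by rewrite mulrCA -exprD [(l + j)%N]addnC.
have w0 := loc_unit_neq0 Uw.
have -> : z ^+ j / p = - 1 * (v / w).
  have -> : z ^+ j = - (p * v) / w by rewrite -E mulfK.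
  by field; rewrite p0 w0.
apply: loc_unitM; last by apply: loc_unitM => //; apply: loc_unitV.
by apply: loc_unitA; rewrite ?rpredN ?rpred1.
Qed.

(** After division of [trimmed_deriv] by [p] the constant term is a unit, whereas [z ^+ k.+1 / p] is
    the unit [z ^+ j / p] times a positive power of [z]. *)
Lemma trimmed_root_deriv z : z \in P -> root G z -> U (z * G^`().[z] / p).
Proof.
move=> zP Gz; rewrite (trimmed_deriv km Gz).
have [b mE qb] := ffact_prime_part q_prime kq i0k km q_val.
have -> : ((m - k)%:R * (m ^_ k)%:R - z ^+ k.+1) / p =
    ((m - k) * b)%:R + (- 1) * z ^+ i0.+1 * (z ^+ j / p).
  rewrite mE !natrM -pE.
  have -> : k.+1 = (i0.+1 + j)%N by rewrite addSn subnKC // ltnW.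
  by rewrite exprD; field.
apply: loc_unitD.
  apply: loc_unitA => //; apply: notdvd; rewrite Euclid_dvdM // negb_or qb andbT.
  exact: (not_dvdn_sub_degree kq i0k km q_val).
rewrite mulrC; apply: loc_maxM; first exact/loc_unitW/trimmed_root_val.
by apply/loc_maxP/PM; rewrite ?rpredN ?rpred1 // exprSr PM // rpredX // PA.
Qed.

(** Here the roles in [trimmed_deriv] are exchanged: the constant is divisible by [q] and the power
    of [z] is a unit. *)
Lemma trimmed_root_deriv_unit z : z \in A -> z \notin P -> root G z -> U (G^`().[z]).
Proof.
move=> zA zP Gz; have z0 := notP_neq0 zP.
have -> : G^`().[z] = z^-1 * (z * G^`().[z]) by rewrite mulKf.
apply: loc_unitM; first exact/loc_unitV/loc_unitA.
rewrite (trimmed_deriv km Gz) addrC; apply: loc_unitD.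
  by apply: loc_unitA; rewrite rpredN ?notP_exp ?rpredX.
apply: loc_maxM; first exact: loc_ringA.
have [b -> qb] := ffact_prime_part q_prime kq i0k km q_val.
by rewrite mulnC natrM -pE; apply/loc_maxP/PM.
Qed.

Lemma trimmed_root_prod (r : 'I_k -> L) :
  G = \prod_i ('X - (r i)%:P) -> U ((\prod_i r i) / p).
Proof.
move=> GE; have [b mE qb] := ffact_prime_part q_prime kq i0k km q_val.
have : G.[0] = \prod_i (- r i).
  by rewrite GE horner_prod; apply: eq_bigr => i _; rewrite hornerXsubC sub0r.
rewrite horner_coef0 coef_poly /= subn0 mE natrM -pE prodrN => E.
have -> : (\prod_i r i) / p = (-1) ^+ #|'I_k| * b%:R.
  apply: (mulIf p0); rewrite mulfVK // -mulrA [b%:R * p]mulrC E.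
  by rewrite mulrA -expr2 sqrr_sign mul1r.
apply: loc_unitM; last by apply: loc_unitA => //; apply: notdvd.
by apply: loc_unitX; apply: loc_unitA; rewrite ?rpredN ?rpred1.
Qed.
End TrimmedRoots.

(** * Inertia and decomposition groups *)

Variables (gT : finGroupType) (act : gT -> {rmorphism L -> L}).
Hypothesis act1 : forall x, act 1%g x = x.
Hypothesis actM : forall s t x, act (s * t)%g x = act t (act s x).
Hypothesis actA : forall s, {in A, forall x, act s x \in A}.
Hypothesis actp : forall s, act s p = p.
Hypothesis fixed_val : forall x, x != 0 -> (forall s, act s x = x) ->
  exists n1 n2 u, U u /\ x * p ^+ n2 = p ^+ n1 * u.
Hypothesis nilp : forall x, x \in P ->
  exists t y a, [/\ y \in A, y \notin P, a \in A & x ^+ t * y = p * a].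

Definition inertia := [set s | `[< {in A, forall a, act s a - a \in P} >]].
(** One inclusion is enough, because the inverse of [s] is a power of [s]. *)
Definition decomposition := [set s | `[< {in P, forall x, act s x \in P} >]].
Local Notation I := inertia.
Local Notation D := decomposition.

Lemma inertiaP s : reflect {in A, forall a, act s a - a \in P} (s \in I).
Proof. by rewrite inE; apply: asboolP. Qed.

Lemma decompositionP s : reflect {in P, forall x, act s x \in P} (s \in D).
Proof. by rewrite inE; apply: asboolP. Qed.

Lemma inertia_decomposition s : s \in I -> s \in D.
Proof.
move=> /inertiaP sI; apply/decompositionP => x xP.
by rewrite -[act s x](subrK x) rpredD // sI // PA.
Qed.

Lemma inertia_group_set : group_set I.
Proof.
apply/group_setP; split.
  by apply/inertiaP => a aA; rewrite act1 subrr rpred0.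
move=> s t /inertiaP sI /inertiaP tI; apply/inertiaP => a aA.
by rewrite actM -[_ - a](subrKA (act s a)) rpredD ?sI ?tI ?actA.
Qed.
Canonical inertia_group := Group inertia_group_set.

Lemma decompositionX s n x : s \in D -> x \in P -> act (s ^+ n) x \in P.
Proof.
move=> /decompositionP sD xP; elim: n => [|n IH]; first by rewrite expg0 act1.
by rewrite expgSr actM sD.
Qed.

Lemma decomposition_notP s x : s \in D -> x \notin P -> act s x \notin P.
Proof.
move=> sD; apply: contra => /(decompositionX #[s]%g.-1 sD).
by rewrite -actM -expgS prednK ?order_gt0 // expg_order act1.
Qed.

Lemma decomposition_unit s x : s \in D -> U x -> U (act s x).
Proof.
move=> sD [a [b [aA bA aP bP e]]]; exists (act s a), (act s b).
by rewrite -rmorphM e !actA // !decomposition_notP.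
Qed.

(** Take [x] in [P] with [act s x] outside [P]. By finite order the iterates return to [P], and the
    one just before the first return is the required [y]. *)
Lemma not_decomposition s : s \notin D ->
  exists y, [/\ y \in A, y \notin P & act s y \in P].
Proof.
move=> sD; have [x xP sxP] : exists2 x, x \in P & act s x \notin P.
  move: sD; rewrite inE => /asboolPn/existsNP[x /not_implyP[xP /negP sx]].
  by exists x.
pose Q n := act (s ^+ n.+1) x \in P.
have exQ : exists n, Q n.
  by exists #[s]%g.-1; rewrite /Q prednK ?order_gt0 // expg_order act1.
have := ex_minnP exQ => -[[|n]]; rewrite /Q.
  by rewrite expg1 (negPf sxP).
move=> Qn minQ; exists (act (s ^+ n.+1) x); rewrite -actM -expgSr Qn.
split=> //; first by rewrite actA // PA.
by apply/negP => /(minQ n); rewrite ltnn.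
Qed.

Section InvariantValuation.
Variables (pi : L) (j b : nat).
Hypothesis j0 : (0 < j)%N.
Hypothesis piA : pi \in A.
Hypothesis pi_val : U (pi ^+ j / p ^+ b).
Hypothesis pi_inertia : {in I, forall s, act s pi = pi}.
Hypothesis tame : #|I|%:R \notin P.

Let pi0 : pi != 0.
Proof.
apply: contraPneq pi_val => -> /loc_unit_neq0.
by rewrite expr0n eqn0Ngt j0 mul0r eqxx.
Qed.

Let p_pi : O (p ^+ b / pi).
Proof.
have -> : p ^+ b / pi = (pi ^+ j / p ^+ b)^-1 * pi ^+ j.-1.
  rewrite invf_div -mulrA; congr (_ * _).
  by rewrite -[in RHS](prednK j0) exprS invfM -mulrA mulVf ?mulr1 // expf_neq0.
by apply: loc_ringM; [apply/loc_unitW/loc_unitV|apply: loc_ringA; rewrite rpredX].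
Qed.

Let act_pi s : s \in D -> O (act s pi / pi).
Proof.
move=> sD; apply: (loc_ring_root j0); apply: loc_unitW.
have -> : (act s pi / pi) ^+ j = act s (pi ^+ j / p ^+ b) / (pi ^+ j / p ^+ b).
  rewrite rmorphM rmorphV ?unitfE ?expf_neq0 // !rmorphXn /= actp expr_div_n.
  by rewrite invf_div mulrA mulfVK // expf_neq0.
by apply: loc_unitM; [apply: decomposition_unit|apply: loc_unitV].
Qed.

Let separator s : s \notin D ->
  exists e, [/\ e \in A, e \notin P & M (act s (e * pi) / pi)].
Proof.
move=> /not_decomposition[y [yA yP syP]]; have [t [z [a [zA zP aA e]]]] := nilp syP.
(* Of the factors [act s y], the first [t * b] produce [p ^+ b], which makes up for the division by
   [pi]; the last one brings the result into the maximal ideal. *)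
exists (y ^+ (t * b).+1); rewrite rpredX // notP_exp //; split=> //.
have -> : act s (y ^+ (t * b).+1 * pi) / pi =
    (a ^+ b * act s pi * (p ^+ b / pi)) * (act s y / z ^+ b).
  have z0 : z ^+ b != 0 by rewrite expf_neq0 // notP_neq0.
  rewrite rmorphM rmorphXn /= exprSr exprM.
  have -> : (act s y ^+ t) ^+ b = (p * a) ^+ b / z ^+ b by rewrite -e exprMn mulfK.
  by rewrite exprMn; field; rewrite pi0 z0.
apply: loc_maxM.
  by apply: loc_ringM => //; apply: loc_ringA; rewrite rpredM ?rpredX ?actA.
by exists (act s y), (z ^+ b); rewrite rpredX // notP_exp // mulfVK // expf_neq0 // notP_neq0.
Qed.

(* As in Dedekind's independence of characters, passing from the functional [F]
   to [c |-> act t (a t) * F c - F (a t * c)] kills the term [s = t]. *)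
Let independence (w : gT -> L) (a : gT -> L) (r : seq gT) :
  (forall s, s \in r -> a s \in A) ->
  {in A, forall c, M (\sum_(s in D) w s * act s c)} ->
  {in A, forall c, M (\sum_(s in D)
    (w s * \prod_(t <- r) (act t (a t) - act s (a t))) * act s c)}.
Proof.
move=> + w0; elim: r => [_|t r IH ar] c cA.
  under eq_bigr => s _ do rewrite big_nil mulr1.
  exact: w0.
have {}IH := IH (fun s sr => ar s (mem_behead (s := t :: r) sr)).
have aA : a t \in A by rewrite ar ?mem_head.
set W := fun s => w s * \prod_(u <- r) (act u (a u) - act s (a u)).
have -> : \sum_(s in D) w s * (\prod_(u <- t :: r) (act u (a u) - act s (a u))) * act s c =
  act t (a t) * (\sum_(s in D) W s * act s c) - \sum_(s in D) W s * act s (a t * c).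
  rewrite mulr_sumr -sumrB; apply: eq_bigr => s _.
  by rewrite big_cons /W rmorphM; ring.
apply: loc_maxB; first by apply: loc_maxM; [apply/loc_ringA/actA|apply: IH].
by apply: IH; rewrite rpredM.
Qed.

(* The trace of [c * e * pi] is rational, and has the valuation [b / j] of [pi]
   once [e] makes the terms outside the decomposition group negligible and [c]
   is chosen so that the remaining terms do not cancel modulo [P]. *)
Theorem invariant_valuation : (j %| b)%N.
Proof.
have /choice[e eP] s : exists e, s \notin D ->
    [/\ e \in A, e \notin P & M (act s (e * pi) / pi)].
  case sD: (s \in D); first by exists 0.
  by have [e eP] := separator (negbT sD); exists e.
have /choice[a aP] s : exists a, s \notin I -> a \in A /\ act s a - a \notin P.
  case sI: (s \in I); first by exists 0.
  move/negbT: sI; rewrite inE => /asboolPn/existsNP[a /not_implyP[aA /negP sa]].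
  by exists a.
pose e0 := \prod_(s | s \notin D) e s.
have [e0A e0P] : e0 \in A /\ e0 \notin P by apply: notP_prod => s /eP[].
pose w s := act s (e0 * pi) / pi.
have w_out s c : s \notin D -> c \in A -> M (w s * act s c).
  move=> sD cA; rewrite /w /e0 (bigD1 s) //=; set f := \prod_(i | _) _.
  have [esA _ esM] := eP _ sD.
  have fA : f \in A by apply: rpred_prod => t /andP[/eP[]].
  have -> : act s (e s * f * pi) / pi * act s c =
      (act s f * act s c) * (act s (e s * pi) / pi).
    by rewrite !rmorphM; ring.
  by apply: loc_maxM => //; apply: loc_ringA; rewrite rpredM ?actA.
have w_in s : s \in D -> O (w s).
  move=> sD; rewrite /w rmorphM -mulrA; apply: loc_ringM; last exact: act_pi.
  by apply: loc_ringA; rewrite actA.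
have w_I s : s \in I -> w s = act s e0.
  by move=> sI; rewrite /w rmorphM pi_inertia // mulfK.
(* Otherwise the functional vanishes modulo the maximal ideal. Killing the terms outside [I] by
   [independence] and evaluating at 1 leaves [#|I|] terms, all congruent to [e0 * v] with [e0] and
   [v] outside [P]; by tameness their sum is a unit. *)
have [c cA FU] : exists2 c, c \in A & U (\sum_(s in D) w s * act s c).
  apply: contrapT => noc.
  have w0 : {in A, forall c, M (\sum_(s in D) w s * act s c)}.
    move=> c cA; have [||//] := @loc_ring_cases (\sum_(s in D) w s * act s c).
      apply: loc_ring_sum => s sD; apply: loc_ringM; first exact: w_in.
      by apply: loc_ringA; rewrite actA.
    by move=> Uc; case: noc; exists c.
  have ar s : s \in enum [predC I] -> a s \in A by rewrite mem_enum => /aP[].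
  have := independence ar w0 (rpred1 A).
  rewrite (bigID (mem I)) /= addrC big1 ?add0r; last first.
    move=> s /andP[_ sI]; rewrite (bigD1_seq s) ?enum_uniq ?mem_enum //=.
    by rewrite subrr mul0r mulr0 mul0r.
  pose v := \prod_(t <- enum [predC I]) (act t (a t) - a t).
  have [vA vP] : v \in A /\ v \notin P.
    rewrite /v big_seq; apply: notP_prod => t; rewrite mem_enum => /aP[atA atP].
    by rewrite rpredB ?actA.
  have congI s : s \in I ->
    e0 * v - w s * \prod_(t <- enum [predC I]) (act t (a t) - act s (a t)) \in P.
    move=> sI.
    have congM x y x' y' : x \in A -> y \in A -> x' \in A -> y' \in A ->
       x - x' \in P -> y - y' \in P -> x * y - x' * y' \in P.
      move=> xA yA xA' yA' dx dy.
      have -> : x * y - x' * y' = y * (x - x') + x' * (y - y') by ring.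
      by rewrite rpredD // PM.
    have sI1 x : x \in A -> x - act s x \in P.
      by move=> xA; rewrite -opprB rpredN; move/inertiaP: sI; apply.
    have [] : [/\ \prod_(t <- enum [predC I]) (act t (a t) - a t) \in A,
      \prod_(t <- enum [predC I]) (act t (a t) - act s (a t)) \in A &
      \prod_(t <- enum [predC I]) (act t (a t) - a t) -
      \prod_(t <- enum [predC I]) (act t (a t) - act s (a t)) \in P].
      rewrite !big_seq; apply: (big_ind2 (fun x y => [/\ x \in A, y \in A & x - y \in P])).
      - by rewrite !rpred1 subrr rpred0.
      - move=> x1 x2 y1 y2 [x1A x2A dx] [y1A y2A dy].
        by rewrite !rpredM // congM.
      - move=> t; rewrite mem_enum => /aP[atA _].
        have [atA1 atA2] := (actA t atA, actA s atA).
        split; [exact: rpredB|exact: rpredB|].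
        suff -> : forall x y z : L, x - y - (x - z) = - (y - z) by rewrite rpredN sI1.
        by move=> x y z; ring.
    by move=> *; rewrite w_I //; apply: congM; rewrite ?actA ?sI1.
  move=> Msum; have : M (#|I|%:R * (e0 * v)).
    rewrite mulr_natl -sumr_const.
    under eq_bigl => s do rewrite -[s \in I](andb_idl (@inertia_decomposition s)).
    rewrite -[\sum_(i | _) _](subrK (\sum_(i | (i \in D) && (i \in I)) w i * (\prod_(t <- enum [predC I]) (act t (a t) - act i (a t))) * act i 1)).
    apply: loc_maxD => //; rewrite -sumrB; apply: loc_max_sum => s /andP[_ sI].
    by rewrite rmorph1 mulr1; apply/loc_maxP/congI.
  move/loc_max_notunit; apply; apply: loc_unitA; rewrite ?rpredM ?rpred_nat //.
  by rewrite !notP_mul ?rpredM ?rpred_nat.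
pose T := \sum_s act s (c * e0 * pi).
have UT : U (T / pi).
  have -> : T / pi = \sum_(s in D) w s * act s c + \sum_(s | s \notin D) w s * act s c.
    rewrite mulr_suml (bigID (mem D)) /=.
    by congr (_ + _); apply: eq_bigr => s _; rewrite /w !rmorphM; ring.
  apply: loc_unitD => //; apply: loc_max_sum => s sD; exact: w_out.
have T0 : T != 0 by apply: contraPneq (loc_unit_neq0 UT) => ->; rewrite mul0r eqxx.
have fixT s : act s T = T.
  rewrite rmorph_sum [RHS](reindex_inj (mulIg s)) /=.
  by apply: eq_bigr => t _; rewrite actM.
have [n1 [n2 [u [Uu Tu]]]] := fixed_val T0 fixT.
(* [T] is a unit times [p ^+ n1 / p ^+ n2] and also a unit times [pi]; compare the [j]-th powers. *)
have : (b + n2 * j = n1 * j)%N.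
  apply: (@loc_unit_expp _ _ (u ^+ j / ((T / pi) ^+ j * (pi ^+ j / p ^+ b)))).
    apply: loc_unitM; first exact: loc_unitX.
    by apply: loc_unitV; apply: loc_unitM => //; apply: loc_unitX.
  rewrite exprD [in LHS]exprM [in RHS]exprM expr_div_n.
  have : (T * p ^+ n2) ^+ j = (p ^+ n1 * u) ^+ j by rewrite Tu.
  rewrite !exprMn => E.
  have -> : (p ^+ n2) ^+ j = (p ^+ n1) ^+ j * u ^+ j / T ^+ j.
    by rewrite -E mulrC mulKf // expf_neq0.
  have Tj : T ^+ j != 0 by rewrite expf_neq0.
  have pij : pi ^+ j != 0 by rewrite expf_neq0.
  have pb : p ^+ b != 0 by rewrite expf_neq0.
  by field; rewrite Tj pij pb.
by move/(congr1 (dvdn j)); rewrite dvdn_mull // dvdn_addl ?dvdn_mull.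
Qed.
End InvariantValuation.

(** * Inertia acting on the roots *)

Section Roots.
Variables (k : nat) (r : 'I_k -> L) (perm : gT -> {perm 'I_k}) (j : nat).
Hypothesis r_inj : injective r.
Hypothesis rA : forall i, r i \in A.
Hypothesis actr : forall s i, act s (r i) = r (perm s i).
Let dr i := \prod_(i' | i' != i) (r i - r i').
Hypothesis j0 : (0 < j)%N.
Hypothesis rP : forall i, r i \in P -> U (r i ^+ j / p).
Hypothesis prod_r : U ((\prod_i r i) / p).
Hypothesis drP : forall i, r i \in P -> U (r i * dr i / p).
Hypothesis drU : forall i, r i \notin P -> U (dr i).

Definition small_roots := [set i | r i \in P].
Local Notation Delta := small_roots.

Let act_perm s t i : perm (s * t)%g i = perm t (perm s i).
Proof. by apply: r_inj; rewrite -!actr actM. Qed.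

(** The product of all roots has valuation 1, each small root contributes [1 / j] to it and the
    others contribute nothing. *)
Lemma card_small_roots : #|Delta| = j.
Proof.
have U1 : U ((\prod_(i in Delta) r i) ^+ j / p ^+ #|Delta|).
  by apply: expp_unit_prod => i; rewrite inE; apply: rP.
have U2 : U (\prod_(i | i \notin Delta) r i).
  by apply: loc_unit_prod => i; rewrite inE => /loc_unitA; apply.
have U3 := loc_unitX j prod_r.
rewrite (bigID (mem Delta)) /= in U3.
have n1 := loc_unit_neq0 U1; have n2 := loc_unit_neq0 U2; have n3 := loc_unit_neq0 U3.
apply: (loc_unit_expp (loc_unitM U3 (loc_unitM (loc_unitV U1) (loc_unitV (loc_unitX j U2))))).
set x := \prod_(i in _) _ in n1 n3 *; set y := \prod_(i | _) _ in n2 n3 *.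
have x0 : x != 0.
  by apply: contraNneq n3 => ->; rewrite !mul0r expr0n eqn0Ngt j0.
by rewrite !expr_div_n exprMn; field; rewrite !expf_neq0.
Qed.

(** If [s] moved [i], then [r i - r (perm s i)] would be an element of [P] among the factors of the
    unit [dr i]. *)
Lemma inertia_fixes s i : s \in I -> i \notin Delta -> perm s i = i.
Proof.
move=> /inertiaP sI; rewrite inE => iP; apply/eqP; apply: contraT => ne.
have := drU iP; rewrite /dr (bigD1 (perm s i)) //= => /(@loc_max_notunit _); case.
rewrite mulrC; apply: loc_maxM.
  by apply/loc_ringA/rpred_prod => i' _; rewrite rpredB.
by apply: loc_maxP; rewrite -opprB rpredN -actr sI.
Qed.

(** The product of the roots over the inertia orbit of [i] is fixed by inertia, so
    [invariant_valuation] makes the orbit size a multiple of [j], the number of small roots. *)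
Lemma inertia_transitive (tame : #|I|%:R \notin P) i i' :
  i \in Delta -> i' \in Delta -> exists2 s, s \in I & perm s i = i'.
Proof.
move=> iD i'D; pose B := [set perm s i | s in I].
have BD : B \subset Delta.
  apply/fintype.subsetP => _ /imsetP[s sI ->]; rewrite inE -actr.
  have /decompositionP := inertia_decomposition sI; apply.
  by move: iD; rewrite inE.
suff /eqP BE : B == Delta by move: i'D; rewrite -BE => /imsetP[s sI ->]; exists s.
rewrite eqEcard BD card_small_roots dvdn_leq //.
  by apply/card_gt0P; exists (perm 1%g i); apply/imsetP; exists 1%g => //; apply: group1.
apply: (@invariant_valuation (\prod_(i in B) r i) j #|B|) => //.
- by rewrite rpred_prod.
- apply: expp_unit_prod => x xB; apply: rP.
  by have /(_ xB) := fintype.subsetP BD x; rewrite inE.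
move=> s sI; rewrite rmorph_prod [RHS](reindex_inj (@perm_inj _ (perm s))) /=.
apply: eq_big => x; last by rewrite actr.
apply/imsetP/imsetP => -[t tI].
  by move=> ->; exists (t * s)%g; [exact: groupM|rewrite act_perm].
move=> e; exists (t * s^-1)%g; first by rewrite groupM ?groupV.
by rewrite act_perm -e -act_perm mulgV; apply: r_inj; rewrite -actr act1.
Qed.

(* The discriminant has valuation [j - 1], so that its square root cannot be
   rational when [j] is even. *)
Lemma odd_perm_exists : ~~ odd j -> exists s, odd_perm (perm s).
Proof.
move=> even_j; apply: contrapT => noodd.
pose V := Vandermonde k (\row_i r i); pose d := \det V.
have fixd s : act s d = d.
  rewrite /d -det_map_mx.
  have -> : map_mx (act s) V = col_perm (perm s) V.
    by apply/matrixP => x y; rewrite !mxE rmorphXn /= actr.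
  rewrite col_permE det_mulmx det_perm odd_permV.
  by case os: (odd_perm _); [case: noodd; exists s|rewrite expr0 mulr1].
(* The extra square gets rid of the sign in [\prod_i dr i = +- d ^+ 2]. *)
pose F i i' := (r i - r i') ^+ 2.
have d4 : d ^+ 4 = (\prod_i dr i) ^+ 2.
  have -> : (\prod_i dr i) ^+ 2 = \prod_i \prod_(i' | i' != i) F i i'.
    by rewrite -prodrXl; apply: eq_bigr => i _; rewrite -prodrXl.
  have d2 : d ^+ 2 = \prod_(i < k) \prod_(i' < k | (i < i')%N) F i i'.
    rewrite /d det_Vandermonde -prodrXl; apply: eq_bigr => i _.
    rewrite -prodrXl; apply: eq_bigr => i' _.
    by rewrite /F !mxE -sqrrN opprB.
  rewrite (exprM _ 2 2) d2 expr2 {2}(exchange_big_dep xpredT) //=.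
  rewrite -big_split /=; apply: eq_bigr => i _.
  rewrite [RHS](bigID (fun i' : 'I_k => (i < i')%N)) /=; congr (_ * _).
    by apply: eq_bigl => i'; rewrite -val_eqE /= neq_ltn; case: ltngtP.
  apply: eq_big => i'; last by rewrite /F -sqrrN opprB.
  by rewrite -val_eqE /= neq_ltn; case: ltngtP.
have U1 : U (\prod_(i in Delta) (r i * dr i / p)).
  by apply: loc_unit_prod => i; rewrite inE; apply: drP.
have U2 : U (\prod_(i | i \notin Delta) (r i * dr i)).
  by apply: loc_unit_prod => i; rewrite inE => iP; apply: loc_unitM; [apply: loc_unitA|apply: drU].
have dU : U ((\prod_i dr i) / p ^+ j.-1).
  set a := \prod_(i in _) _ in U1; set b := \prod_(i | _) _ in U2.
  have E : (\prod_i r i) * (\prod_i dr i) = a * p ^+ j * b.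
    rewrite -big_split (bigID (mem Delta)) /=; congr (_ * _).
    by rewrite /a prodf_div prodr_const card_small_roots mulfVK // expf_neq0.
  have x0 : \prod_i r i != 0.
    by apply: contraPneq (loc_unit_neq0 prod_r) => ->; rewrite mul0r eqxx.
  have -> : (\prod_i dr i) / p ^+ j.-1 = a * b * ((\prod_i r i) / p)^-1.
    have -> : \prod_i dr i = a * p ^+ j * b / \prod_i r i by rewrite -E mulrC mulKf.
    rewrite -[in p ^+ j](prednK j0) exprS.
    have pj : p ^+ j.-1 != 0 by rewrite expf_neq0.
    by field; rewrite p0 x0 pj.
  by apply: loc_unitM; [apply: loc_unitM|apply: loc_unitV].
have d0 : d != 0.
  apply: contraPneq (loc_unit_neq0 dU) => d0; move: d4; rewrite d0 expr0n /=.
  by move/esym/eqP; rewrite expf_eq0 /= => /eqP ->; rewrite mul0r eqxx.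
have [n1 [n2 [u [Uu e]]]] := fixed_val d0 fixd.
(* [d ^+ 4] has valuation [2 * (j - 1)], and the invariant [d] has an integral valuation, so 4
   divides [2 * (j - 1)] and [j] is odd. *)
have : (j.-1 * 2 + n2 * 4 = n1 * 4)%N.
  apply: (@loc_unit_expp _ _ (u ^+ 4 / ((\prod_i dr i) / p ^+ j.-1) ^+ 2)).
    by apply: loc_unitM; [apply: loc_unitX|apply/loc_unitV/loc_unitX].
  have E : (\prod_i dr i) ^+ 2 * p ^+ (n2 * 4) = p ^+ (n1 * 4) * u ^+ 4.
    by rewrite -d4 !exprM -!exprMn e.
  have D0 : (\prod_i dr i) ^+ 2 != 0 by rewrite -d4 expf_neq0.
  rewrite mulrA -[in RHS]E expr_div_n -exprM exprD.
  have pj : p ^+ (j.-1 * 2) != 0 by rewrite expf_neq0.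
  have {}D0 : \prod_i dr i != 0 by move: D0; rewrite expf_eq0.
  by field; rewrite D0 pj.
move: even_j; rewrite -(prednK j0) /= negbK.
clear; lia.
Qed.
End Roots.
End Localisation.

(** * Number fields *)

Section PrimeIdeal.
Local Open Scope classical_set_scope.
Local Open Scope ring_scope.

Lemma exists_prime_ideal (L : fieldType) (A : subringClosed L) (q : L) :
  q \in A -> q != 0 -> q^-1 \notin A ->
  exists P : zmodClosed L, [/\ {subset P <= A}, {in A & P, forall a x, a * x \in P},
    1 \notin P, {in A &, forall a b, a * b \in P -> (a \in P) || (b \in P)} & q \in P].
Proof.
move=> qA q0 qV.
pose ideal (S : set L) := [/\ forall x, S x -> x \in A, forall x y, S x -> S y -> S (x - y),
   forall a x, a \in A -> S x -> S (a * x), S q & ~ S 1].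
pose Q (S : set L) := S = set0 \/ ideal S.
have [|S [QS maxS]] := @Zorn_bigcup L Q.
  move=> F FQ Ftot.
  case: (pselect (exists2 X, F X & ideal X)) => [[X FX [XA XB XM Xq X1]]|no].
    right; have FI Y y : F Y -> Y y -> ideal Y.
      by move=> FY Yy; case: (FQ _ FY) => // Y0; rewrite Y0 in Yy.
    split.
    - by move=> x [Y FY Yx]; have [+ _ _ _ _] := FI _ _ FY Yx; apply.
    - move=> x y [Y FY Yx] [Z FZ Zy].
      have [_ YB _ _ _] := FI _ _ FY Yx; have [_ ZB _ _ _] := FI _ _ FZ Zy.
      case: (Ftot _ _ FY FZ) => [sub|sub].
        by exists Z => //; apply: ZB => //; apply: sub.
      by exists Y => //; apply: YB => //; apply: sub.
    - move=> a x aA [Y FY Yx]; have [_ _ + _ _] := FI _ _ FY Yx.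
      by move=> YM; exists Y => //; apply: YM.
    - by exists X.
    - by move=> [Y FY Y1]; have [_ _ _ _] := FI _ _ FY Y1; apply.
  left; apply/seteqP; split=> // x [Y FY Yx].
  case: (FQ _ FY) => [Y0|YI]; first by rewrite Y0 in Yx.
  by case: no; exists Y.
have Iq : ideal [set x | exists2 a, a \in A & x = q * a].
  split.
  - by move=> _ [a aA ->]; rewrite rpredM.
  - by move=> _ _ [a aA ->] [b bA ->]; exists (a - b); rewrite ?rpredB // mulrBr.
  - by move=> a _ aA [b bA ->]; exists (a * b); rewrite ?rpredM // mulrCA.
  - by exists 1; rewrite ?rpred1 ?mulr1.
  - move=> [a aA e]; case/negP: qV; suff -> : q^-1 = a by [].
    by apply: (mulfI q0); rewrite -e divff.
have IS : ideal S.
  case: QS => // S0; case: (maxS [set x | exists2 a, a \in A & x = q * a]); last by right.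
  rewrite S0; split=> // sub; case: (sub q).
  by exists 1; rewrite ?rpred1 ?mulr1.
have [SA SB SM Sq S1] := IS.
have S0 : S 0 by rewrite -(subrr q); apply: SB.
pose Pp : {pred L} := [pred x | `[< S x >]].
have PpE x : (x \in Pp) = `[< S x >] by [].
have Pz : zmod_closed Pp.
  split; first by rewrite PpE; apply/asboolP.
  by move=> x y /asboolP Sx /asboolP Sy; rewrite PpE; apply/asboolP/SB.
pose P : zmodClosed L := HB.pack_for (zmodClosed L) Pp (GRing.isZmodClosed.Build L Pp Pz).
have PE x : (x \in P) = `[< S x >] by [].
exists P; split.
- by move=> x; rewrite PE => /asboolP/SA.
- by move=> a x aA; rewrite !PE => /asboolP Sx; apply/asboolP/SM.
- by rewrite PE; apply/asboolP.
- move=> a b aA bA; rewrite !PE => /asboolP Sab.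
  case: (pselect (S a)) => [Sa|nSa]; first by apply/orP; left; apply/asboolP.
  apply/orP; right; apply/asboolP.
  pose J := [set x | exists s c, [/\ S s, c \in A & x = s + a * c]].
  have SJ : S `<=` J by move=> x Sx; exists x, 0; rewrite rpred0 mulr0 addr0.
  have Ja : J a by exists 0, 1; rewrite rpred1 mulr1 add0r.
  case: (pselect (J 1)) => [[s [c [Ss cA e]]]|J1].
    have -> : b = b * s + c * (a * b).
      by rewrite -[LHS]mulr1 e; ring.
    rewrite -[c * _]opprK -[- (c * _)]sub0r; apply: (SB _ _ (SM _ _ bA Ss)).
    by apply: (SB _ _ S0); apply: SM.
  case: (maxS J); first by split=> // /(_ a Ja).
  right; split=> //.
  - by move=> _ [s [c [Ss cA ->]]]; apply: rpredD; [exact: SA|exact: rpredM].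
  - move=> _ _ [s [c [Ss cA ->]]] [t [d [St dA ->]]]; exists (s - t), (c - d).
    by rewrite rpredB //; split; [exact: SB| |ring].
  - move=> d _ dA [s [c [Ss cA ->]]]; exists (d * s), (d * c).
    by rewrite rpredM //; split; [exact: SM| |ring].
  - by apply: SJ.
- by rewrite PE; apply/asboolP.
Qed.

End PrimeIdeal.

Section AlgebraicIntegers.
Local Open Scope ring_scope.
Variables (L : fieldExtType rat) (QsC : {rmorphism L -> algC}).

Definition algint : {pred L} := fun x => QsC x \in Aint.
Let A := algint.

Lemma algintE x : (x \in algint) = (QsC x \in Aint). Proof. by []. Qed.

Fact algint_subring : subring_closed algint.
Proof.
split; first by rewrite algintE rmorph1 Aint1.
  by move=> x y; rewrite !algintE rmorphB => xA yA; rewrite rpredB.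
by move=> x y; rewrite !algintE rmorphM => xA yA; rewrite rpredM.
Qed.
HB.instance Definition _ := GRing.isSubringClosed.Build L algint algint_subring.

Lemma algint_monic (pz : {poly int}) x : pz \is monic ->
  root (map_poly intr pz) x -> x \in algint.
Proof.
move=> pm px; rewrite algintE; apply: (@root_monic_Aint (map_poly intr pz)).
- have -> : map_poly intr pz = map_poly QsC (map_poly intr pz) :> {poly algC}.
    by rewrite -map_poly_comp; apply: eq_map_poly => a /=; rewrite rmorph_int.
  by rewrite fmorph_root.
- exact: monic_map.
- by apply/polyOverP => i; rewrite coef_map /= intr_int.
Qed.

Lemma algint_poly x : x \in algint ->
  exists2 pz : {poly int}, pz \is monic & root (map_poly intr pz) x.
Proof.
rewrite algintE => xA; have /floorpP[pz Dp] : QsC x \in Aint by [].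
exists pz.
  have := minCpoly_monic (QsC x); rewrite Dp !monicE lead_coef_map_inj //.
    by rewrite -(eqr_int algC).
  exact: intr_inj.
rewrite -(fmorph_root QsC); have := root_minCpoly (QsC x); rewrite Dp.
congr root; rewrite -map_poly_comp; apply: eq_map_poly => a /=.
by rewrite rmorph_int.
Qed.

Lemma algint_root n x : (0 < n)%N -> x ^+ n \in algint -> x \in algint.
Proof.
move=> n0 /algint_poly[pz pm px].
apply: (@algint_monic (pz \Po 'X^n)).
  rewrite monicE lead_coef_comp ?size_polyXn //.
  by rewrite (monicP pm) (monicP (monicXn _ _)) expr1n mulr1.
by rewrite map_comp_poly map_polyXn /root horner_comp hornerXn.
Qed.

Lemma algint_nat_inv q : (1 < q)%N -> (q%:R : L)^-1 \notin algint.
Proof.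
move=> q1; rewrite algintE fmorphV rmorph_nat; apply/negP => qA.
have q0 : (0 < q)%N := ltnW q1.
have Zq : (q%:R : algC)^-1 \is a Num.int.
  by apply: Cint_rat_Aint => //; rewrite rpredV rpred_nat.
have := norm_intr_ge1 Zq; rewrite invr_eq0 pnatr_eq0 -lt0n q0 => /(_ isT).
rewrite normfV normr_nat invf_ge1 ?ltr0n // -[1]/(1%:R) ler_nat.
by rewrite leqNgt q1.
Qed.

Variables (P : zmodClosed L) (q : nat).
Hypothesis q_prime : prime q.
Hypothesis PA : {subset P <= algint}.
Hypothesis PM : {in algint & P, forall a x, a * x \in P}.
Hypothesis P1 : 1 \notin P.
Hypothesis qP : q%:R \in P.

Lemma prime_notdvd n : ~~ (q %| n)%N -> n%:R \notin P.
Proof.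
move=> qn; apply/negP => nP; case/negP: P1.
have n0 : (0 < n)%N by case: n qn {nP} => //; rewrite dvdn0.
have [u v e _] := egcdnP q n0.
have /eqP cop : coprime n q by rewrite coprime_sym prime_coprime.
have -> : 1 = u%:R * n%:R - v%:R * q%:R :> L.
  by rewrite -!natrM e cop natrD addrC addKr.
by rewrite rpredB // PM // rpred_nat.
Qed.

Lemma prime_notdvdz (z : int) : ~~ (q%:Z %| z)%Z -> z%:~R \notin P.
Proof.
case: z => n; first exact: prime_notdvd.
rewrite NegzE dvdzE abszN rmorphN rpredN; exact: (@prime_notdvd n.+1).
Qed.

(** In a monic integral equation of [x], let [t] be the least index of a coefficient prime to [q].
    The part from degree [t] on is [x ^+ t] times an element congruent to that coefficient modulo
    [P]; the rest is a multiple of [q]. *)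
Lemma prime_nilpotent x : x \in P ->
  exists t y a, [/\ y \in algint, y \notin P, a \in algint & x ^+ t * y = q%:R * a].
Proof.
move=> xP; have xA := PA xP; have [pz pm /eqP px] := algint_poly xA.
have exn : exists n, ~~ (q%:Z %| pz`_n)%Z.
  exists (size pz).-1; have /eqP := pm; rewrite lead_coefE => ->.
  by rewrite dvdz1 /=; apply: contraTneq q_prime => ->.
have [t qt mint] := ex_minnP exn.
have tn : (t < size pz)%N.
  by rewrite ltnNge; apply: contra qt => /(nth_default 0)->; rewrite dvdz0.
have rI (z : int) : z%:~R \in algint by rewrite rpred_int.
exists t, (\sum_(i < size pz - t) (pz`_(i + t))%:~R * x ^+ i),
  (- \sum_(i < t) ((pz`_i %/ q%:Z)%Z)%:~R * x ^+ i).
split.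
- by apply: rpred_sum => i _; rewrite rpredM ?rpredX.
- rewrite -(prednK (_ : 0 < size pz - t)%N) ?subn_gt0 // big_ord_recl expr0 mulr1.
  set S := \sum_(i < _) _; have SP : S \in P.
    apply: rpred_sum => i _; rewrite PM //= /bump /= add1n exprSr PM ?rpredX //.
  apply/negP => /(fun h => rpredB h SP); rewrite addrK add0n.
  by apply/negP; apply: prime_notdvdz.
- by rewrite rpredN; apply: rpred_sum => i _; rewrite rpredM ?rpredX.
rewrite mulrN; apply/eqP; rewrite -addr_eq0; apply/eqP; rewrite -[RHS]px.
rewrite (horner_coef_wide _ (n := t + (size pz - t))); last first.
  by rewrite subnKC ?(ltnW tn) // size_map_poly_id0 ?leqnn // (monicP pm) oner_neq0.
rewrite big_split_ord /= [LHS]addrC; congr (_ + _).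
  rewrite mulr_sumr; apply: eq_bigr => i _; rewrite coef_map /= mulrA; congr (_ * _).
  have qi : (q%:Z %| pz`_i)%Z.
    by apply: contraT => /mint; rewrite leqNgt ltn_ord.
  by rewrite -[in RHS](divzK qi) rmorphM /= mulrC.
rewrite mulr_sumr; apply: eq_bigr => i _; rewrite coef_map /= mulrCA -exprD.
by rewrite [(t + i)%N]addnC.
Qed.
End AlgebraicIntegers.

Section NumberFieldGalois.
Local Open Scope ring_scope.
Variables (L : splittingFieldType rat) (QsC : {rmorphism L -> algC}).
Hypothesis galL : galois 1 {:L}.
Local Notation gT := (gal_of {:L}).

Let act (s : gT) : {rmorphism L -> L} := s.

Let act1 x : act 1%g x = x. Proof. exact: gal_id. Qed.

Let actM s t x : act (s * t)%g x = act t (act s x).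
Proof. by rewrite /act /= galM ?memvf. Qed.

Let actA s : {in algint QsC, forall x, act s x \in algint QsC}.
Proof.
move=> x; rewrite !algintE; have [nu nuE] := extend_algC_subfield_aut QsC (act s).
by rewrite nuE Aint_aut.
Qed.

Lemma fixed_rational x : (forall s : gT, s x = x) -> exists c : rat, x = in_alg L c.
Proof.
move=> fx; have : x \in fixedField 'Gal({:L} / 1)%g.
  by apply/fixedFieldP => [|s _]; [exact: memvf|exact: fx].
rewrite (elimT galois_fixedField galL) => /vlineP[c ->].
by exists c; rewrite in_algE.
Qed.

Section Prime.
Variables (P : zmodClosed L) (q : nat).
Hypothesis q_prime : prime q.
Hypothesis PA : {subset P <= algint QsC}.
Hypothesis PM : {in algint QsC & P, forall a x, a * x \in P}.
Hypothesis P1 : 1 \notin P.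
Hypothesis Pprime : {in algint QsC &, forall a b, a * b \in P -> (a \in P) || (b \in P)}.
Hypothesis qP : q%:R \in P.

Let U := loc_unit (algint QsC) P.

Let q0 : q%:R != 0 :> L.
Proof. by rewrite -(fmorph_eq0 QsC) rmorph_nat pnatr_eq0 -lt0n prime_gt0. Qed.

Lemma nat_val n : (0 < n)%N -> exists e u, U u /\ n%:R = q%:R ^+ e * u :> L.
Proof.
move=> n0; exists (logn q n), (n`_q^')%:R; split.
  apply: (loc_unitA P1); first exact: rpred_nat.
  apply: (prime_notdvd q_prime PM P1 qP).
  by rewrite -p'natE // part_pnat.
by rewrite -natrX -natrM -p_part partnC.
Qed.

Lemma rational_val (x : L) : x != 0 -> (forall s : gT, act s x = x) ->
  exists n1 n2 u, U u /\ x * q%:R ^+ n2 = q%:R ^+ n1 * u.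
Proof.
move=> x0 /fixed_rational[c xc].
have c0 : c != 0 by apply: contraNneq x0 => c0; rewrite xc c0 rmorph0.
have [n1 [u1 [U1 e1]]] : exists e u, U u /\ (numq c)%:~R = q%:R ^+ e * u :> L.
  have : (0 < `|numq c|)%N by rewrite absz_gt0 numq_eq0.
  move=> /nat_val[e [u [Uu E]]].
  case: (numq c) E => n /= E; first by exists e, u.
  exists e, (- 1 * u); split.
    apply: loc_unitM => //; apply: (loc_unitA P1); first by rewrite rpredN rpred1.
    by rewrite rpredN.
  by rewrite NegzE rmorphN /= -[_%:~R]/(n.+1%:R) E; ring.
have [n2 [u2 [U2 e2]]] : exists e u, U u /\ (denq c)%:~R = q%:R ^+ e * u :> L.
  have : (0 < `|denq c|)%N by rewrite absz_gt0 denq_neq0.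
  move=> /nat_val[e [u [Uu E]]]; exists e, u; split=> //.
  by rewrite -E -[_%:R]/(`|denq c|%N%:~R) gtz0_abs // denq_gt0.
exists n1, n2, (u1 / u2); split.
  by apply: loc_unitM => //; apply: loc_unitV.
have u20 : u2 != 0 by apply: loc_unit_neq0 U2.
rewrite xc -[c]divq_num_den rmorphM fmorphV !rmorph_int e1 e2.
have qn : q%:R ^+ n2 != 0 :> L by rewrite expf_neq0.
by field; rewrite u20 qn.
Qed.
End Prime.

Section TrimmedRoots.
Variables (m k : nat).
Hypothesis km : (k <= m)%N.
Local Notation G := (trimmed L m k).

Lemma trimmed_root_algint z : root G z -> z \in algint QsC.
Proof.
move=> Gz; apply: (@algint_monic _ _ (trimmed int m k)); first exact: trimmed_monic.
suff -> : map_poly intr (trimmed int m k) = G by [].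
apply/polyP => i; rewrite coef_map /= !coef_poly; case: ifP => // _.
by rewrite rmorph_nat.
Qed.

Section RamifiedPrime.
Variables (q i0 : nat).
Hypotheses (q_prime : prime q) (kq : (k < q)%N) (i0k : (i0 < k)%N).
Hypothesis q_val : logn q (m - i0) = 1%N.

Let q0 : q%:R != 0 :> L.
Proof. by rewrite -(fmorph_eq0 QsC) rmorph_nat pnatr_eq0 -lt0n prime_gt0. Qed.

Let exP : exists P : zmodClosed L, [/\ {subset P <= algint QsC},
    {in algint QsC & P, forall a x, a * x \in P}, 1 \notin P,
    {in algint QsC &, forall a b, a * b \in P -> (a \in P) || (b \in P)} & q%:R \in P].
Proof.
apply: exists_prime_ideal => //; first exact: rpred_nat.
by apply: algint_nat_inv; apply: prime_gt1.
Qed.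

(** Separability comes for free from a ramified prime: the valuation of the derivative at the root
    is finite, whether or not the root lies in [P]. *)
Lemma trimmed_simple_roots z : root G z -> G^`().[z] != 0.
Proof.
move=> Gz; have [P [PA PM P1 Pprime qP]] := exP.
have notd := prime_notdvd q_prime PM P1 qP.
case zP: (z \in P).
  have := trimmed_root_deriv PA PM P1 Pprime qP q0 q_prime kq i0k km q_val erefl notd zP Gz.
  by move=> /loc_unit_neq0; apply: contraNneq => ->; rewrite mulr0 mul0r.
have := trimmed_root_deriv_unit PA PM P1 Pprime qP q_prime kq i0k km q_val erefl.
by move=> /(_ z (trimmed_root_algint Gz) (negbT zP) Gz) /loc_unit_neq0.
Qed.

Variables (r : 'I_k -> L) (perm : gT -> {perm 'I_k}).
Hypothesis GE : G = \prod_i ('X - (r i)%:P).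
Hypothesis r_inj : injective r.
Hypothesis actr : forall s i, act s (r i) = r (perm s i).
Hypothesis gen : <<1 & codom r>>%VS = fullv.

(** The Galois group embeds into the permutations of the roots. As [q > k], this gives tameness. *)
Lemma card_gal_dvdn (I : {group gT}) : (#|I| %| k`!)%N.
Proof.
have permM : {in [set: gT] &, {morph perm : s t / (s * t)%g}}.
  by move=> s t _ _; apply/permP => i; apply: r_inj; rewrite permM -!actr actM.
pose f := Morphism permM.
have injf : ('injm f)%g.
  apply/injmP => s t _ _ /= st; apply/eqP/gal_eqP => x _.
  have : (<<1 & codom r>> <= fixedField [set (s * t^-1)%g])%VS.
    apply/Fadjoin_seqP; split; first exact: sub1v.
    move=> _ /codomP[i ->]; apply/fixedFieldP => [|u /set1P->]; first exact: memvf.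
    by rewrite galM ?memvf // [s _]actr st -actr /act -galM ?memvf // mulgV gal_id.
  rewrite gen => /subvP/(_ x (memvf _))/mem_fixedFieldP[_ /(_ _ (set11 _))].
  rewrite galM ?memvf // => e.
  by rewrite -[in RHS]e -galM ?memvf // mulVg gal_id.
rewrite -(card_injm injf (finset.subsetT I)) -card_Sn -cardsT.
exact/cardSg/finset.subsetT.
Qed.

Lemma trimmed_inertia : exists (I : {set gT}) (Delta : {set 'I_k}),
  [/\ #|Delta| = (k - i0)%N,
   forall s i, s \in I -> i \notin Delta -> perm s i = i,
   forall i i', i \in Delta -> i' \in Delta -> exists2 s, s \in I & perm s i = i' &
   ~~ odd (k - i0) -> exists s, odd_perm (perm s)].
Proof.
have [P [PA PM P1 Pprime qP]] := exP.
have notd := prime_notdvd q_prime PM P1 qP.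
have j0 : (0 < k - i0)%N by rewrite subn_gt0.
have Gr i : root G (r i).
  by rewrite GE /root horner_prod (bigD1 i) //= hornerXsubC subrr mul0r.
have rA i : r i \in algint QsC by apply: trimmed_root_algint.
pose dr i := \prod_(i' | i' != i) (r i - r i').
have drE i : G^`().[r i] = dr i by rewrite GE deriv_prod_XsubC.
have rP i : r i \in P -> loc_unit (algint QsC) P (r i ^+ (k - i0) / q%:R).
  move=> riP; apply: (trimmed_root_val PA PM P1 Pprime qP q0 q_prime kq i0k km q_val) => //.
have prod_r : loc_unit (algint QsC) P ((\prod_i r i) / q%:R).
  exact: (trimmed_root_prod P1 Pprime q0 q_prime kq i0k km q_val erefl notd GE).
have drP i : r i \in P -> loc_unit (algint QsC) P (r i * dr i / q%:R).
  by move=> riP; rewrite -drE; apply: (trimmed_root_deriv PA PM P1 Pprime qP q0 q_prime kq i0k km q_val).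
have drU i : r i \notin P -> loc_unit (algint QsC) P (dr i).
  by move=> riP; rewrite -drE; apply: (trimmed_root_deriv_unit PA PM P1 Pprime qP q_prime kq i0k km q_val).
have actp s : act s q%:R = q%:R by rewrite rmorph_nat.
have fv := rational_val q_prime PM P1 Pprime qP.
have np := prime_nilpotent q_prime PA PM P1 qP.
have root_ax : forall n (x : L), (0 < n)%N -> x ^+ n \in algint QsC -> x \in algint QsC.
  exact: algint_root.
exists (inertia (algint QsC) P act), (small_roots P r); split.
- exact: (card_small_roots PA PM P1 Pprime qP q0 rA j0 rP prod_r).
- move=> s i sI iD; apply: (inertia_fixes PM P1 Pprime rA actr drU sI iD).
- move=> i i' iD i'D.
  have tame : #|inertia (algint QsC) P act|%:R \notin P.
    apply: notd; rewrite -prime_coprime //.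
    apply: coprime_dvdr (card_gal_dvdn (inertia_group P act1 actM actA)) _.
    rewrite prime_coprime //; apply/negP => /(prime_dvd_fact q_prime).
    by rewrite leqNgt kq.
  exact: (inertia_transitive PA PM P1 Pprime root_ax qP q0 act1 actM actA actp fv np r_inj rA actr j0 rP prod_r tame iD i'D).
- move=> odd_j.
  exact: (odd_perm_exists PA PM P1 Pprime qP q0 fv rA actr j0 rP prod_r drP drU odd_j).
Qed.

End RamifiedPrime.
End TrimmedRoots.

End NumberFieldGalois.

(** * From prime divisors of the shifts to the full symmetric group *)

Section FullSymmetric.
Local Open Scope ring_scope.

Definition large_exact_prime (k m i : nat) : Prop :=
  exists q, [/\ prime q, (k < q)%N & logn q (m - i) = 1%N].

Lemma polyC_alg_trexp m k : (k <= m)%N ->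
  polyC_alg (trexp (m - k) m) = (m`!%:R)^-1 *: trimmed algC m k.
Proof.
move=> km; apply/polyP => i; rewrite coef_map coefZ !coef_poly subKn //.
case: ifP => ik; last by rewrite mulr0 raddf0.
have ik' : (k - i <= m)%N by apply: leq_trans km; apply: leq_subr.
have f0 n : (n`!%:R : algC) != 0 by rewrite pnatr_eq0 -lt0n fact_gt0.
rewrite /= fmorphV rmorph_nat; apply: (mulfI (f0 m)); rewrite mulrA divff // mul1r.
rewrite -(ffact_fact ik') natrM.
have -> : (m - (k - i) = m - k + i)%N by move: ik; rewrite ltnS => ik; lia.
by rewrite mulfK.
Qed.

Lemma perm_of_act (k : nat) (T : eqType) (r : 'I_k -> T) (f : T -> T) :
  injective r -> (forall i, f (r i) \in codom r) -> {in codom r &, injective f} ->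
  exists p : {perm 'I_k}, forall i, f (r i) = r (p i).
Proof.
move=> r_inj fr f_inj.
have /choice[g gE] : forall i, exists i', f (r i) = r i'.
  by move=> i; have /codomP := fr i.
have g_inj : injective g.
  move=> i i' e; apply: r_inj; apply: f_inj; rewrite ?codom_f //.
  by rewrite !gE e.
by exists (perm g_inj) => i; rewrite permE.
Qed.

Lemma trimmed_splitting_field m k : (0 < k)%N -> (k <= m)%N -> large_exact_prime k m 0 ->
  exists (L : splittingFieldType rat) (QsC : {rmorphism L -> algC}) (r : 'I_k -> L),
  [/\ galois 1 {:L}, injective r, trimmed L m k = \prod_i ('X - (r i)%:P) &
   <<1 & codom r>>%VS = fullv].
Proof.
move=> k0 km [q [q_prime kq q_val]].
have [s sE] := closed_field_poly_normal (trimmed algC m k).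
rewrite (monicP (trimmed_monic _ _ _)) scale1r in sE.
have [L0 [QsC [s1 s1E gen]]] := num_field_exists s.
have mapT (F : fieldExtType rat) (h : {rmorphism F -> algC}) :
    map_poly h (trimmed F m k) = trimmed algC m k.
  apply/polyP => i; rewrite coef_map /= !coef_poly.
  by case: ifP; rewrite ?rmorph0 ?rmorph_nat.
have GE : trimmed L0 m k = \prod_(z <- s1) ('X - z%:P).
  apply: (map_poly_inj QsC); rewrite mapT sE -s1E big_map rmorph_prod.
  by apply: eq_bigr => z _; rewrite rmorphB /= map_polyX map_polyC.
have sz : size s1 == k.
  by have := size_trimmed L0 m k; rewrite GE size_prod_XsubC => -[->].
pose t := Tuple sz; pose r := tnth t.
have tE : codom r = s1 by rewrite codomE map_tnth_enum.
have splitG : splittingFieldFor 1 (trimmed L0 m k) {:L0}.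
  by exists s1 => //; rewrite GE eqpxx.
have G1 : trimmed L0 m k \is a polyOver 1%VS.
  by apply/polyOverP => i; rewrite coef_poly; case: ifP; rewrite ?rpred0 ?rpred_nat.
have ax : FieldExt_isSplittingField _ L0 by constructor; exists (trimmed L0 m k).
pose L := HB.pack_for (splittingFieldType rat) L0 ax.
have GE' : trimmed L0 m k = \prod_i ('X - (r i)%:P) by rewrite GE (big_tuple _ _ t).
have r_inj : injective r.
  move=> i i' e; apply/eqP; apply: contraT => ne.
  have Gi : root (trimmed L0 m k) (r i).
    by rewrite GE' /root horner_prod (bigD1 i) //= hornerXsubC subrr mul0r.
  have := @trimmed_simple_roots L QsC m k km q 0 q_prime kq k0 q_val (r i) Gi.
  by rewrite GE' deriv_prod_XsubC (bigD1 i') 1?eq_sym //= e subrr mul0r eqxx.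
exists L, QsC, r; split=> //; last by rewrite tE.
apply/splitting_galoisField; exists (trimmed L0 m k); split=> //.
by rewrite GE separable_prod_XsubC; apply/(@tuple_uniqP _ _ t).
Qed.

Theorem trexp_full_symmetric m k j : (k <= m)%N -> (2 < k)%N ->
  large_exact_prime k m 0 -> large_exact_prime k m 1 ->
  (1 < j <= k)%N -> (j <= 2)%N || (8 * j <= k)%N -> large_exact_prime k m (k - j) ->
  galois_group_is_full_symmetric (trexp (m - k) m).
Proof.
move=> km k2 g0 g1 /andP[j1 jk] jsmall gj.
have k0 : (0 < k)%N by apply: leq_trans k2.
have [L [QsC [r [galL r_inj GE gen]]]] := trimmed_splitting_field k0 km g0.
have rootL z : root (trimmed L m k) z = (z \in codom r).
  have -> : trimmed L m k = \prod_(z <- codom r) ('X - z%:P).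
    by rewrite GE codomE big_map enumT.
  by rewrite root_prod_XsubC.
pose gT := gal_of {:L}.
pose act (s : gT) : {rmorphism L -> L} := s.
have /choice[rho rhoE] : forall s : gT, exists p : {perm 'I_k}, forall i, s (r i) = r (p i).
  move=> s; apply: perm_of_act => //; last by move=> x y _ _; apply: (fmorph_inj (act s)).
  move=> i; rewrite -rootL.
  have <- : map_poly (act s) (trimmed L m k) = trimmed L m k.
    apply/polyP => l; rewrite coef_map /= !coef_poly.
    by case: ifP; rewrite ?rmorph0 ?rmorph_nat.
  by rewrite (fmorph_root (act s)) rootL codom_f.
have rhoM s t : rho (s * t)%g = (rho s * rho t)%g.
  by apply/permP => i; apply: r_inj; rewrite permM -!rhoE galM ?memvf.
have H_group : group_set [set rho s | s : gT].
  apply/group_setP; split.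
    apply/imsetP; exists 1%g => //; apply/permP => i; apply: r_inj.
    by rewrite -rhoE perm1 gal_id.
  by move=> _ _ /imsetP[s _ ->] /imsetP[t _ ->]; rewrite -rhoM imset_f.
pose H := Group H_group.
have rhoH s : rho s \in H by apply: imset_f.
have inertia i0 : (i0 < k)%N -> large_exact_prime k m i0 ->
   exists (I : {set gT}) (Delta : {set 'I_k}),
  [/\ #|Delta| = (k - i0)%N,
   forall s i, s \in I -> i \notin Delta -> rho s i = i,
   forall i i', i \in Delta -> i' \in Delta -> exists2 s, s \in I & rho s i = i' &
   ~~ odd (k - i0) -> exists s, odd_perm (rho s)].
  move=> i0k [q [q_prime kq q_val]].
  exact: (@trimmed_inertia L QsC galL m k km q i0 q_prime kq i0k q_val r rho GE r_inj rhoE gen).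
have [I0 [D0 [cD0 _ tr0 odd0]]] := inertia 0 k0 g0.
have [I1 [D1 [cD1 fix1 tr1 odd1]]] := inertia 1 (ltn_trans (ltnSn 1) k2) g1.
have [|Ij [Dj [cDj fixj trj _]]] := inertia (k - j)%N _ gj.
  by rewrite ltn_subrL k0 (ltn_trans _ j1).
have D0T x : x \in D0.
  suff -> : D0 = [set: 'I_k] by rewrite inE.
  by apply/eqP; rewrite eqEcard finset.subsetT cD0 cardsT card_ord subn0 leqnn.
have [x0 x0D] : exists x0, x0 \notin D1.
  apply/existsP; rewrite -negb_forall; apply/negP => /forallP D1T.
  move: cD1; have -> : D1 = [set: 'I_k] by apply/setP => x; rewrite D1T inE.
  by rewrite cardsT card_ord; lia.
have D1E x : x != x0 -> x \in D1.
  move=> xx0; apply: contraT => xD.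
  have := subset_leq_card (_ : D1 \subset ~: [set x; x0]).
  rewrite [X in (_ <= X)%N]cardsCs finset.setCK cD1 cards2 xx0 card_ord => /(_ _).
  have h : D1 \subset ~: [set x; x0].
    apply/fintype.subsetP => y yD; rewrite !inE negb_or.
    by apply/andP; split; apply: contraTneq yD => ->.
  by move/(_ h); lia.
(* Move [x] and [x'] to [x0], the only root outside [D1]; inertia for the shift 1 fixes [x0] and is
   transitive on the other roots. *)
have H2 x y x' y' : x != y -> x' != y' -> exists2 h, h \in H & h x = x' /\ h y = y'.
  move=> xy xy'.
  have [s _ sx] := tr0 x x0 (D0T _) (D0T _).
  have [s' _ sx'] := tr0 x' x0 (D0T _) (D0T _).
  have [||t tI ty] := tr1 (rho s y) (rho s' y').
  - by apply: D1E; rewrite -sx (inj_eq perm_inj) eq_sym.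
  - by apply: D1E; rewrite -sx' (inj_eq perm_inj) eq_sym.
  exists (rho s * rho t * (rho s')^-1)%g; first by rewrite !groupM ?groupV ?rhoH.
  rewrite !permM sx fix1 // ty; split; last by rewrite permK.
  by rewrite -sx' permK.
(* An inertia element for the shift [k - j] that moves one of its [j] small roots to another; it
   fixes all other roots. *)
have [a [aH a1 sa]] : exists a, [/\ a \in H, a != 1%g &
    (#|supp a| <= 2)%N || (8 * #|supp a| <= #|'I_k|)%N].
  have cj : #|Dj| = j by rewrite cDj subKn.
  have [x [y [xD yD xy]]] : exists x y, [/\ x \in Dj, y \in Dj & x != y].
    by apply/card_gt1P; rewrite cj.
  have [s sI sx] := trj x y xD yD.
  have sub : (#|supp (rho s)| <= j)%N.
    rewrite -cj; apply/subset_leq_card/fintype.subsetP => z; rewrite inE.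
    by apply: contraR => zD; rewrite fixj.
  exists (rho s); split=> //.
    by apply: contraNneq xy => s1; rewrite -sx s1 perm1.
  rewrite card_ord; case/orP: jsmall => h; apply/orP; [left|right].
    exact: leq_trans sub h.
  by apply: leq_trans h; rewrite leq_mul2l sub.
(* One of [k] and [k - 1] is even, so the discriminant argument applies to the shift 0 or to the
   shift 1. *)
have [h hH hodd] : exists2 h, h \in H & odd_perm h.
  case ok : (odd k).
    have [|s so] := odd1; first by rewrite oddB ?ok //= ltnW // ltnW.
    by exists (rho s).
  by have [|s so] := odd0; [rewrite subn0 ok|exists (rho s)].
have allH := sym_of_small_support H2 aH a1 sa hH hodd.
have pE := polyC_alg_trexp km.
have fact0 : (m`!%:R : algC)^-1 != 0 by rewrite invr_eq0 pnatr_eq0 -lt0n fact_gt0.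
have rootC z : root (polyC_alg (trexp (m - k) m)) z = (z \in [seq QsC x | x <- codom r]).
  rewrite pE rootZ //.
  have -> : trimmed algC m k = \prod_(z <- [seq QsC x | x <- codom r]) ('X - z%:P).
    have <- : map_poly QsC (trimmed L m k) = trimmed algC m k.
      apply/polyP => i; rewrite coef_map /= !coef_poly.
      by case: ifP; rewrite ?rmorph0 ?rmorph_nat.
    rewrite GE codomE -map_comp big_map enumT rmorph_prod /=.
    by apply: eq_bigr => z' _; rewrite rmorphB /= map_polyX map_polyC.
  by rewrite root_prod_XsubC.
have sz : size (trexp (m - k) m) = k.+1.
  by rewrite /trexp subKn // size_poly_eq // invr_eq0 pnatr_eq0 -lt0n fact_gt0.
split; first by rewrite -size_poly_eq0 sz.
split.
  exists [seq QsC x | x <- codom r]; split=> //.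
    rewrite map_inj_uniq; last exact: fmorph_inj.
    by rewrite map_inj_uniq ?enum_uniq.
  by rewrite size_map size_codom card_ord sz.
move=> f f_root f_inj.
pose rC i := QsC (r i).
have rC_inj : injective rC by move=> i i' /fmorph_inj/r_inj.
have codC z : (z \in codom rC) = root (polyC_alg (trexp (m - k) m)) z.
  by rewrite rootC !codomE -[in RHS]map_comp.
have [p pf] : exists p : {perm 'I_k}, forall i, f (rC i) = rC (p i).
  apply: perm_of_act => //.
    by move=> i; rewrite codC; apply: f_root; rewrite -topredE /= -codC codom_f.
  by move=> x y; rewrite !codC => hx hy; apply: f_inj.
have /imsetP[s _ ps] := allH p.
have [u uE] := extend_algC_subfield_aut QsC (act s).
exists u => z; rewrite -topredE /= -codC => /codomP[i ->].
by rewrite pf /rC -uE /act /= rhoE ps.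
Qed.
End FullSymmetric.

(** * Reciprocals of primes *)

Lemma fact_prime_prod n :
  n`! = \prod_(0 <= p < n.+1 | prime p) p ^ logn p n`!.
Proof.
rewrite -[LHS](partnT (fact_gt0 n)) (@widen_partn (n + n`!)) ?leq_addl //.
rewrite (big_cat_nat (n := n.+1)) //=; last by rewrite ltnS leq_addr.
rewrite [X in _ * X]big_nat_cond [X in _ * X]big1 ?muln1; last first.
  move=> p /andP[/andP[np _] _].
  rewrite lognE; case: and3P => // -[pr _ pd]; exfalso.
  by move: (prime_dvd_fact pr pd) np; lia.
rewrite [RHS]big_mkcond [LHS]big_mkcond /=; apply: eq_bigr => p _.
by case: ifP => //= np; rewrite lognE np.
Qed.

Section PrimeSums.
Local Open Scope ring_scope.
Variable R : realType.
Local Notation lnn n := (ln (n%:R : R)).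

Lemma ln_prod (I : Type) (r : seq I) (Q : pred I) (F : I -> R) :
  (forall i, Q i -> 0 < F i) ->
  ln (\prod_(i <- r | Q i) F i) = \sum_(i <- r | Q i) ln (F i).
Proof.
move=> F0; suff [] : 0 < \prod_(i <- r | Q i) F i /\
  ln (\prod_(i <- r | Q i) F i) = \sum_(i <- r | Q i) ln (F i) by [].
apply: (big_rec2 (fun x y => 0 < x /\ ln x = y)) => [|i y x Qi [x0 <-]].
  by rewrite ln1.
by rewrite lnM ?posrE ?F0 // mulr_gt0 ?F0.
Qed.

Lemma ln_fact n :
  lnn n`! = \sum_(0 <= p < n.+1 | prime p) (logn p n`!)%:R * lnn p.
Proof.
rewrite {1}fact_prime_prod natr_prod ln_prod; last first.
  by move=> p pr; rewrite natrX exprn_gt0 // ltr0n prime_gt0.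
by apply: eq_bigr => p pr; rewrite natrX lnXn ?ltr0n ?prime_gt0 // mulr_natl.
Qed.

Lemma lnn_ge0 n : 0 <= lnn n.
Proof. by case: n => [|n]; [rewrite ln0|apply: ln_ge0; rewrite ler1n]. Qed.

Lemma ler_lnn m n : (m <= n)%N -> lnn m <= lnn n.
Proof.
case: m => [|m] mn; first by rewrite ln0 // lnn_ge0.
by rewrite ler_ln ?posrE ?ltr0n ?ler_nat //; apply: leq_trans mn.
Qed.

Lemma ln_fact_ub n : lnn n`! <= n%:R * lnn n.
Proof.
elim: n => [|n IH]; first by rewrite ln1 mul0r.
have ln_le := ler_lnn (leqnSn n).
rewrite factS natrM lnM ?posrE ?ltr0n ?fact_gt0 //; move: ln_le; set b := lnn n.+1 => ln_le.
rewrite -natr1 mulrDl mul1r addrC lerD2r.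
by apply: le_trans IH _; rewrite ler_wpM2l.
Qed.

Lemma ln_fact_lb n : n%:R * lnn n - n%:R <= lnn n`!.
Proof.
elim: n => [|[|n] IH]; first by rewrite mul0r subrr ln1.
  by rewrite ln1 mulr0 sub0r oppr_le0.
rewrite factS natrM lnM ?posrE ?ltr0n ?fact_gt0 //.
have l1 : lnn n.+2 - lnn n.+1 <= (n.+1%:R)^-1.
  rewrite -ln_div ?posrE ?ltr0n //.
  have -> : n.+2%:R / n.+1%:R = 1 + (n.+1%:R)^-1 :> R.
    by rewrite -[n.+2%:R]natr1 mulrDl divff ?mul1r // pnatr_eq0.
  by apply: le_ln1Dx; apply: lt_trans (_ : 0 < _); rewrite ?ltrN10 // invr_gt0 ltr0n.
have : n.+1%:R * (lnn n.+2 - lnn n.+1) <= 1.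
  by rewrite mulrC -ler_pdivlMr ?ltr0n // div1r.
move: IH; set a := lnn n.+1; set b := lnn n.+2; set c := lnn _`!.
by rewrite -[n.+2%:R]natr1 mulrBr mulrDl mul1r; lra.
Qed.

Lemma sum_ln_prime_ub y :
  \sum_(0 <= p < y.+1 | prime p) lnn p / p%:R <= 2 * lnn y.
Proof.
have [->|y0] := posnP y; first by rewrite big_mkcond big_nat1 /= ln0 // mulr0.
rewrite -(ler_pM2l (_ : 0 < y%:R)) ?ltr0n //.
apply: le_trans (_ : 2 * lnn y`! <= _); last first.
  by rewrite mulrCA ler_pM2l ?ltr0n // ln_fact_ub.
rewrite ln_fact !mulr_sumr big_nat_cond [leRHS]big_nat_cond.
apply: ler_sum => p /andP[/andP[_ py] pr].
rewrite [leLHS]mulrA [leLHS]mulrAC [leRHS]mulrA; apply: ler_wpM2r; first exact: lnn_ge0.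
rewrite ler_pdivrMr ?ltr0n ?prime_gt0 // -!natrM ler_nat.
(* [y %/ p >= y / (2 * p)] as [p <= y], which saves Chebyshev's bound on [\sum_p ln p]. *)
have : (y %/ p <= logn p y`!)%N.
  by rewrite logn_fact // big_ltn // expn1 leq_addr.
have := ltn_ceil y (prime_gt0 pr).
have : (0 < y %/ p)%N by rewrite divn_gt0 ?prime_gt0.
set q := (y %/ p)%N; nia.
Qed.

(** Legendre's formula with a geometric series of sum [1 / (p - 1) <= 2 / p]. *)
Lemma logn_fact_ub p n : prime p -> (logn p n`!)%:R <= n%:R * (2 / p%:R) :> R.
Proof.
move=> pr; rewrite logn_fact // natr_sum.
have p2 : 2 <= p%:R :> R by rewrite ler_nat prime_gt1.
have p0 : 0 < p%:R :> R by rewrite ltr0n prime_gt0.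
have geo N : \sum_(1 <= k < N.+1) (p%:R ^+ k)^-1 <= (1 - (p%:R ^+ N)^-1) * (2 / p%:R) :> R.
  elim: N => [|N IH]; first by rewrite big_geq // expr0 invr1 subrr mul0r.
  rewrite big_nat_recr //=; apply: le_trans (lerD IH (lexx _)) _.
  rewrite exprS invfM; set x := (p%:R ^+ N)^-1.
  have x0 : 0 <= x by rewrite invr_ge0 exprn_ge0 // ltW.
  set v := p%:R^-1.
  have v2 : v <= 1 / 2 by rewrite div1r lef_pV2 ?posrE.
  have v0 : 0 <= v by rewrite invr_ge0 ltW.
  have : 0 <= x * v by rewrite mulr_ge0.
  nra.
apply: le_trans (_ : n%:R * \sum_(1 <= k < n.+1) (p%:R ^+ k)^-1 <= _).
  rewrite mulr_sumr; apply: ler_sum => k _; rewrite -natrX.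
  rewrite ler_pdivlMr ?ltr0n ?expn_gt0 ?prime_gt0 //.
  by rewrite -natrM ler_nat leq_trunc_div.
rewrite ler_wpM2l //; apply: le_trans (geo n) _.
have le1 : 1 - (p%:R ^+ n)^-1 <= 1 :> R by rewrite gerBl invr_ge0 exprn_ge0 // ltW.
by rewrite -[leRHS]mul1r ler_wpM2r ?divr_ge0 ?(ltW p0).
Qed.

(** Expand [ln N!] over primes, with [l = ln y]. The primes up to [y] contribute at most
    [4 * l * N], the others at most [16 * l * S * N], while Stirling's lower bound is
    [(8 * l - 1) * N]. With [l >= 1 / 2] this gives [S >= 1 / 8]; the exponent 8 is there to exceed
    the loss [4 + 1 / l <= 6]. *)
Lemma sum_recip_prime_lb y : (3 <= y)%N ->
  1 / 8 <= \sum_(y.+1 <= p < (y ^ 8).+1 | prime p) (p%:R)^-1 :> R.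
Proof.
move=> y3; set N := (y ^ 8)%N; set S := \sum_(_ <= _ < _ | _) _.
have y0 : 0 < y%:R :> R by rewrite ltr0n; apply: leq_trans y3.
have N0 : 0 < N%:R :> R by rewrite natrX exprn_gt0.
have yN : (y <= N)%N by rewrite -[X in (X <= _)%N]expn1 leq_exp2l // (leq_trans _ y3).
have lN : lnn N = 8 * lnn y by rewrite natrX lnXn // mulr_natl.
have ly1 : 1 / 2 <= lnn y.
  apply: le_trans (ler_lnn y3).
  have := @le_ln1Dx R (- (2 / 3)); have -> : 1 + - (2 / 3) = 3^-1 :> R by lra.
  by rewrite lnV ?posrE //; lra.
have up : lnn N`! <= N%:R * (4 * lnn y + 16 * lnn y * S).
  rewrite ln_fact; apply: le_trans (_ : \sum_(0 <= p < N.+1 | prime p) N%:R * (2 / p%:R) * lnn p <= _).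
    by apply: ler_sum => p pr; rewrite ler_wpM2r ?lnn_ge0 ?logn_fact_ub.
  under eq_bigr do rewrite -!mulrA.
  rewrite -!mulr_sumr ler_pM2l //.
  rewrite (big_cat_nat (n := y.+1)) //= mulrDr; apply: lerD.
    apply: le_trans (_ : 2 * (2 * lnn y) <= _); last by rewrite mulrA -natrM.
    rewrite ler_pM2l //; under eq_bigr do rewrite mulrC.
    exact: sum_ln_prime_ub.
  rewrite /S -mulrA -[16]/((2 * 8)%:R) natrM -mulrA ler_pM2l // mulrA -lN mulr_sumr.
  rewrite big_nat_cond [leRHS]big_nat_cond; apply: ler_sum => p /andP[/andP[_ pN] _].
  by rewrite mulrC ler_wpM2r ?invr_ge0 // ler_lnn.
have := le_trans (ln_fact_lb N) up.
rewrite -[X in _ - X]mulr1 -mulrBr ler_pM2l // lN.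
move: ly1; set l := lnn y => l1 h.
rewrite leNgt; apply/negP => S8.
have : 0 < l * (1 / 8 - S) by apply: mulr_gt0; lra.
by rewrite mulrBr; lra.
Qed.
End PrimeSums.

(** * The second moment method *)

Lemma sum_dvdn d b N : 0 < d ->
  (\sum_(1 <= m < N.+1) (d %| m + b) + b %/ d = (N + b) %/ d)%N.
Proof.
move=> d0; elim: N => [|N IH]; first by rewrite big_geq.
by rewrite big_nat_recr //= addnAC IH addSn divnS // addnC.
Qed.

(** [d.-1 * i] represents [- i] modulo [d], which avoids truncated subtraction. *)
Lemma eqn_mod_dvd_shift d i m : 0 < d ->
  (m == i %[mod d]) = (d %| m + d.-1 * i).
Proof.
move=> d0; rewrite -(eqn_modDr (d.-1 * i)).
have -> : i + d.-1 * i = i * d by rewrite -mulSn prednK // mulnC.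
by rewrite modnMl.
Qed.

Section SecondMoment.
Local Open Scope ring_scope.
Variable R : realFieldType.

Lemma sum_eqn_mod d i N : (0 < d)%N ->
  N%:R / d%:R - 1 <= (\sum_(1 <= m < N.+1) (m == i %[mod d])%N%:R : R) <= N%:R / d%:R + 1.
Proof.
move=> d0; under eq_bigr do rewrite eqn_mod_dvd_shift //.
rewrite -natr_sum; set b := (d.-1 * i)%N; set S := \sum_(_ <= _ < _) _.
have S_E : (S + b %/ d = (N + b) %/ d)%N by apply: sum_dvdn.
have d0' : 0 < d%:R :> R by rewrite ltr0n.
have e1 : (S * d <= N + d)%N.
  have := leq_trunc_div (N + b) d; rewrite -S_E.
  have := ltn_ceil b d0; nia.
have e2 : (N <= S * d + d)%N.
  have := ltn_ceil (N + b) d0; rewrite -S_E.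
  have := leq_trunc_div b d; nia.
apply/andP; split.
  by rewrite lerBlDr ler_pdivrMr // mulrDl mul1r -natrM -natrD ler_nat.
by rewrite -lerBlDr ler_pdivlMr // mulrBl mul1r lerBlDr -natrM -natrD ler_nat.
Qed.

Lemma sum_eqn_mod2 p q i j N : (0 < p)%N -> (0 < q)%N -> coprime p q ->
  \sum_(1 <= m < N.+1) ((m == i %[mod p])%N%:R * (m == j %[mod q])%N%:R)
    <= N%:R * (p%:R^-1 * q%:R^-1) + 1 :> R.
Proof.
move=> p0 q0 pq; have pq0 : (0 < p * q)%N by rewrite muln_gt0 p0.
have /andP[_] := sum_eqn_mod (chinese p q i j) N pq0.
rewrite natrM invfM; apply: le_trans; apply: ler_sum => m _.
rewrite -natrM mulnb ler_nat chinese_remainder //.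
by rewrite chinese_modl // chinese_modr.
Qed.

(* Chebyshev's inequality for the number of events [e j], which are pairwise
   almost independent of probability [rho j]. *)
Lemma second_moment (T : eqType) (J : seq T) (e : T -> nat -> bool) (rho : T -> R) N
    (mu := \sum_(j <- J) rho j) : uniq J ->
  (forall j, j \in J -> 0 <= rho j <= 1) ->
  (forall j, j \in J ->
     N%:R * rho j - 1 <= \sum_(1 <= m < N.+1) (e j m)%:R <= N%:R * rho j + 1) ->
  (forall j j', j \in J -> j' \in J -> j != j' ->
     \sum_(1 <= m < N.+1) ((e j m)%:R * (e j' m)%:R) <= N%:R * (rho j * rho j') + 1) ->
  (\sum_(1 <= m < N.+1) (~~ has (e^~ m) J)%:R) * mu ^+ 2 <=
     N%:R * mu + 4 * (size J)%:R ^+ 2.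
Proof.
move=> Ju rho01 e1 e2; set n := size J.
pose X m : R := \sum_(j <- J) (e j m)%:R.
have sum1 : \sum_(j <- J) 1 = n%:R :> R by rewrite big_const_seq count_predT iter_addr_0.
have mu0 : 0 <= mu by rewrite /mu big_seq sumr_ge0 // => j /rho01/andP[].
have mu_n : mu <= n%:R.
  by rewrite -sum1 /mu [leLHS]big_seq [leRHS]big_seq; apply: ler_sum => j /rho01/andP[].
have sumX : N%:R * mu - n%:R <= \sum_(1 <= m < N.+1) X m.
  rewrite exchange_big /= mulr_sumr -sum1 -sumrB [leLHS]big_seq [leRHS]big_seq.
  by apply: ler_sum => j /e1/andP[].
have sumX2 : \sum_(1 <= m < N.+1) X m ^+ 2 <= N%:R * mu ^+ 2 + n%:R ^+ 2 + N%:R * mu + n%:R.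
  have -> : \sum_(1 <= m < N.+1) X m ^+ 2 =
      \sum_(j <- J) \sum_(j' <- J) \sum_(1 <= m < N.+1) ((e j m)%:R * (e j' m)%:R).
    under eq_bigr do rewrite expr2 /X mulr_suml.
    rewrite exchange_big /=; apply: eq_bigr => j _.
    by rewrite exchange_big /=; apply: eq_bigr => m _; rewrite mulr_sumr.
  apply: (@le_trans _ _ (\sum_(j <- J) \sum_(j' <- J)
      ((j == j')%:R * (N%:R * rho j + 1) + (N%:R * (rho j * rho j') + 1)))).
    rewrite [leLHS]big_seq [leRHS]big_seq; apply: ler_sum => j jJ.
    rewrite [leLHS]big_seq [leRHS]big_seq; apply: ler_sum => j' jJ'.
    have [<-|ne] := eqVneq j j'; last by rewrite mul0r add0r e2.
    rewrite mul1r; apply: le_trans (_ : N%:R * rho j + 1 <= _).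
      under eq_bigr do rewrite -natrM mulnb andbb.
      by have /andP[] := e1 j jJ.
    rewrite lerDl addr_ge0 // mulr_ge0 //.
    by have /andP[r0 _] := rho01 j jJ; rewrite mulr_ge0.
  have E j : j \in J -> \sum_(j' <- J)
      ((j == j')%:R * (N%:R * rho j + 1) + (N%:R * (rho j * rho j') + 1)) =
      (N%:R * rho j + 1) + (N%:R * mu * rho j + n%:R).
    move=> jJ; rewrite big_split big_split /= sum1 -mulr_suml -mulr_sumr.
    rewrite -mulr_sumr -/mu; congr (_ + _); last by congr (_ + _); ring.
    rewrite -[RHS]mul1r; congr (_ * _).
    rewrite (bigD1_seq j) //= eqxx big1 ?addr0 // => j' ne.
    by rewrite eq_sym (negPf ne).
  rewrite big_seq (eq_bigr _ E) -big_seq !big_split /= sum1 -!mulr_sumr -/mu.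
  have -> : \sum_(i <- J) n%:R = n%:R * n%:R :> R.
    by rewrite -[in LHS](mulr1 n%:R) -mulr_sumr sum1.
  by rewrite le_eqVlt; apply/orP; left; apply/eqP; ring.
(* An [m] at which no event occurs has [X m = 0] and contributes [mu ^+ 2] to the variance. *)
have le1 : (\sum_(1 <= m < N.+1) (~~ has (e^~ m) J)%:R) * mu ^+ 2 <=
    \sum_(1 <= m < N.+1) (X m - mu) ^+ 2.
  rewrite mulr_suml; apply: ler_sum => m _; case: hasPn => [no|_].
    rewrite mul1r /X big_seq big1 ?sub0r ?sqrrN // => j /no /=.
    by case: (e j m).
  by rewrite mul0r sqr_ge0.
apply: le_trans le1 _.
have -> : \sum_(1 <= m < N.+1) (X m - mu) ^+ 2 =
   \sum_(1 <= m < N.+1) X m ^+ 2 - 2 * mu * (\sum_(1 <= m < N.+1) X m) + N%:R * mu ^+ 2.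
  have -> : N%:R * mu ^+ 2 = \sum_(1 <= m < N.+1) mu ^+ 2.
    by rewrite big_const_nat subn1 iter_addr_0 mulr_natl.
  rewrite mulr_sumr -sumrB -big_split /=; apply: eq_bigr => m _; ring.
(* The terms [N * mu ^ 2] cancel and [N * mu + n ^ 2 + n + 2 * mu * n] remains, where [n] and
   [mu * n] are at most [n ^ 2]. *)
have : 0 <= mu * (\sum_(1 <= m < N.+1) X m - (N%:R * mu - n%:R)).
  by rewrite mulr_ge0 // subr_ge0.
have n_n2 : n%:R <= n%:R ^+ 2 :> R by rewrite -natrX ler_nat; case: (n) => // k; nia.
have : mu * n%:R <= n%:R ^+ 2 by rewrite expr2 ler_wpM2r.
move: sumX2; set S2 := \sum_(_ <= _ < _) _; set S1 := \sum_(_ <= _ < _) _.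
rewrite mulrBr !mulrBr => h1 h2 h3.
have E : mu * (N%:R * mu) = N%:R * mu ^+ 2 by ring.
by rewrite E in h3; nra.
Qed.

End SecondMoment.

Definition primes_between (y z : nat) := [seq p <- index_iota y.+1 z.+1 | prime p].
Definition prime_shifts (y z a w : nat) := [seq (p, i) | p <- primes_between y z, i <- iota a w].

Lemma mem_primes_between y z p :
  (p \in primes_between y z) = prime p && (y < p <= z).
Proof. by rewrite mem_filter mem_index_iota ltnS. Qed.

Lemma prime_shiftsP y z a w u : reflect
  [/\ prime u.1, y < u.1 <= z & a <= u.2 < a + w] (u \in prime_shifts y z a w).
Proof.
apply: (iffP allpairsP) => [[[p i] /= [+ + ->]]|[pr pyz ia]] /=.
  by rewrite mem_primes_between mem_iota => /andP[].
exists u; rewrite mem_primes_between mem_iota pr pyz ia; split=> //.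
by case: (u).
Qed.

Lemma uniq_prime_shifts y z a w : uniq (prime_shifts y z a w).
Proof.
apply: allpairs_uniq; rewrite ?filter_uniq ?iota_uniq //.
by move=> [p i] [p' i'] _ _ [-> ->].
Qed.

(* Congruences stand for [u.1 %| m - u.2], where the subtraction could be truncated. *)
Definition shift_divides (u : nat * nat) (m : nat) := m == u.2 %[mod u.1].
Definition shift_divides2 (u : nat * nat) (m : nat) := m == u.2 %[mod u.1 ^ 2].

Section Counting.
Local Open Scope ring_scope.
Variable R : realFieldType.

Definition recip_primes y z : R := \sum_(p <- primes_between y z) (p%:R)^-1.

Lemma has_le_sum (T : Type) (Q : pred T) (J : seq T) :
  (has Q J)%:R <= \sum_(j <- J) (Q j)%:R :> R.
Proof.
elim: J => [|j J IH]; first by rewrite big_nil.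
rewrite big_cons /=; case: (Q j); last by rewrite add0r.
by rewrite lerDl sumr_ge0.
Qed.

Lemma block_count y z a w N : (0 < w)%N -> (w <= y)%N -> 1 <= recip_primes y z ->
  \sum_(1 <= m < N.+1) (~~ has (shift_divides^~ m) (prime_shifts y z a w))%:R
    <= N%:R / (w%:R * recip_primes y z) + 4 * z%:R ^+ 2 :> R.
Proof.
move=> w0 wy L1; set L := recip_primes y z in L1 *.
set d := size (primes_between y z).
have dz : (d <= z)%N.
  rewrite /d size_filter (leq_trans (count_size _ _)) // size_iota; lia.
have L0 : 0 < L by apply: lt_le_trans L1.
have w0' : 0 < w%:R :> R by rewrite ltr0n.
have muE : \sum_(u <- prime_shifts y z a w) (u.1%:R)^-1 = w%:R * L.
  rewrite big_allpairs /= /L /recip_primes mulr_sumr; apply: eq_bigr => p _.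
  by rewrite big_const_seq count_predT size_iota iter_addr_0 mulr_natl.
have sizeE : size (prime_shifts y z a w) = (d * w)%N by rewrite size_allpairs size_iota.
set B := \sum_(_ <= _ < _) _.
have hB : B * (w%:R * L) ^+ 2 <= N%:R * (w%:R * L) + 4 * (d * w)%:R ^+ 2.
  rewrite -muE -sizeE; apply: second_moment; first exact: uniq_prime_shifts.
- move=> u /prime_shiftsP[pr _ _]; rewrite invr_ge0 ler0n /=.
  by rewrite invf_le1 ?ltr0n ?prime_gt0 // ler1n prime_gt0.
- move=> u /prime_shiftsP[pr _ _]; apply: sum_eqn_mod; exact: prime_gt0.
- move=> u v /prime_shiftsP[pr py ua] /prime_shiftsP[pr' py' va] ne.
  (* For equal primes the events exclude each other: distinct shifts in a window of length
     [w <= y < p] are incongruent modulo [p]. *)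
  have [e|ne1] := eqVneq u.1 v.1; last first.
    apply: sum_eqn_mod2; rewrite ?prime_gt0 //.
    by rewrite prime_coprime // dvdn_prime2.
  rewrite big1; first by rewrite addr_ge0 // !mulr_ge0 // invr_ge0.
  move=> m _; rewrite -natrM mulnb /shift_divides -e.
  suff -> : (m == u.2 %[mod u.1]) && (m == v.2 %[mod u.1]) = false by [].
  apply/negP => /andP[/eqP e1 /eqP e2]; case/negP: ne.
  have e3 : u.2 = v.2 %[mod u.1] by rewrite -e1 e2.
  apply/eqP; rewrite [u]surjective_pairing [v]surjective_pairing e; congr (_, _).
  have : forall b c p, (b <= c)%N -> (c < b + p)%N -> b = c %[mod p] -> b = c.
    move=> b c p bc cb /eqP; rewrite eq_sym eqn_mod_dvd // => pd.
    have [cb0|cb0] := posnP (c - b)%N; first by lia.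
    by have := dvdn_leq cb0 pd; lia.
  move=> h; case: (leqP u.2 v.2) => [|/ltnW] uv; [|apply/esym]; apply: (h _ _ u.1) => //.
    by move: py ua va wy; move: (u.1 : nat) (u.2 : nat) (v.2 : nat) => p b c; clear; lia.
  by move: py ua va wy; move: (u.1 : nat) (u.2 : nat) (v.2 : nat) => p b c; clear; lia.
rewrite -(ler_pM2r (_ : 0 < (w%:R * L) ^+ 2)); last by rewrite exprn_gt0 // mulr_gt0.
apply: le_trans hB _; rewrite [leRHS]mulrDl; apply: lerD.
  by rewrite expr2 [leRHS]mulrA mulfVK // gt_eqF // mulr_gt0.
rewrite natrM !exprMn -[leRHS]mulrA ler_pM2l // [leLHS]mulrC.
have : d%:R ^+ 2 <= z%:R ^+ 2 * L ^+ 2 :> R.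
  rewrite -[leLHS]mulr1; apply: ler_pM; rewrite ?sqr_ge0 ?exprn_ege1 //.
  by rewrite lerXn2r ?nnegrE // ler_nat.
move/(ler_wpM2l (sqr_ge0 w%:R)) => h; apply: le_trans h _.
by rewrite mulrCA.
Qed.

Lemma sum_inv_sqr y z : (0 < y)%N ->
  \sum_(y.+1 <= n < z.+1) (n%:R ^+ 2)^-1 <= (y%:R)^-1 :> R.
Proof.
move=> y0; have [zy|yz] := leqP z y; first by rewrite big_geq ?invr_ge0.
suff : \sum_(y.+1 <= n < z.+1) (n%:R ^+ 2)^-1 <= (y%:R)^-1 - (z%:R)^-1 :> R.
  by move/le_trans; apply; rewrite gerBl invr_ge0.
rewrite -(subnKC (ltnW yz)); elim: (z - y)%N => [|k IH].
  by rewrite addn0 big_geq // subrr.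
rewrite addnS big_nat_recr ?leq_addr //=; apply: le_trans (lerD IH (lexx _)) _.
have H (a : R) : 0 < a -> (a + 1) ^- 2 <= a^-1 - (a + 1)^-1.
  move=> a0; have a1 : 0 < a + 1 by rewrite addr_gt0.
  have -> : a^-1 - (a + 1)^-1 = (a * (a + 1))^-1.
    by field; rewrite (lt0r_neq0 a0) (lt0r_neq0 a1).
  by rewrite lef_pV2 ?posrE ?mulr_gt0 ?exprn_gt0 // expr2 ler_pM2r // lerDl.
have := H (y + k)%:R; rewrite ltr0n addn_gt0 y0 natr1 => /(_ isT) h.
by apply: le_trans (lerD (lexx _) h) _; rewrite addrA subrK.
Qed.
End Counting.

(** * The exceptional integers *)

Section Bad.
Local Open Scope ring_scope.
Variable R : realType.

Lemma recip_primes_lb y T : (3 <= y)%N -> T%:R / 8 <= recip_primes R y (y ^ (8 ^ T)).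
Proof.
move=> y3; have y1 : (1 < y)%N by apply: leq_trans y3.
have yT n : (y <= y ^ (8 ^ n))%N by rewrite -[X in (X <= _)%N]expn1 leq_exp2l // expn_gt0.
rewrite /recip_primes /primes_between big_filter.
elim: T => [|T IH]; first by rewrite mul0r expn0 expn1 big_geq.
have le8 : (y ^ (8 ^ T) <= y ^ (8 ^ T.+1))%N by rewrite leq_exp2l // leq_exp2l.
rewrite -natr1 mulrDl (big_cat_nat (n := (y ^ (8 ^ T)).+1)) //=; last by rewrite ltnS yT.
apply: lerD => //. rewrite expnSr expnM; apply: sum_recip_prime_lb.
exact: leq_trans y3 (yT T).
Qed.

(** Shifts below [64 * K] cover all [blocks], which have length [2 ^ s <= K] and index below 64.
    Neither exceptional set depends on the degree [k]. *)
Definition bad_square y z K m := has (shift_divides2^~ m) (prime_shifts y z 0 (64 * K)).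
(* The pair [(s, t)] encodes the block of shifts [t * 2 ^ s <= i < t.+1 * 2 ^ s]. *)
Definition blocks K := [seq (s, t) | s <- [seq s <- iota 0 K | (2 ^ s <= K)%N], t <- iota 0 64].
Definition bad_block y z K m :=
  has (fun st => ~~ has (shift_divides^~ m) (prime_shifts y z (st.2 * 2 ^ st.1) (2 ^ st.1)))
    (blocks K).

(** A union bound over primes and shifts. The choice [y = K ^ 2] made later turns the term in
    [1 / y] into one of order [N / K]. *)
Lemma bad_square_count y z K N : (0 < y)%N ->
  \sum_(1 <= m < N.+1) (bad_square y z K m)%:R
    <= 64 * K%:R * (N%:R / y%:R + z%:R) :> R.
Proof.
move=> y0.
apply: le_trans (_ : \sum_(1 <= m < N.+1) \sum_(u <- prime_shifts y z 0 (64 * K)) (shift_divides2 u m)%:R <= _).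
  by apply: ler_sum => m _; apply: has_le_sum.
rewrite exchange_big big_allpairs /=.
apply: le_trans (_ : \sum_(p <- primes_between y z) \sum_(i <- iota 0 (64 * K)) (N%:R * (p%:R ^+ 2)^-1 + 1) <= _).
  rewrite [leLHS]big_seq [leRHS]big_seq; apply: ler_sum => p; rewrite mem_primes_between => /andP[pr _].
  apply: ler_sum => i _; have p20 : (0 < p ^ 2)%N by rewrite expn_gt0 prime_gt0.
  by have /andP[_] := sum_eqn_mod R i N p20; rewrite natrX.
rewrite exchange_big /= big_const_seq count_predT size_iota iter_addr_0.
rewrite -[_ *+ (64 * K)]mulr_natl natrM ler_wpM2l ?mulr_ge0 // big_split /= -mulr_sumr; apply: lerD.
  rewrite ler_wpM2l // big_filter; apply: le_trans (sum_inv_sqr R z y0).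
  by rewrite big_mkcond; apply: ler_sum => p _; case: ifP => // _; rewrite invr_ge0 exprn_ge0.
rewrite big_const_seq count_predT iter_addr_0 ler_nat size_filter.
rewrite (leq_trans (count_size _ _)) // size_iota; lia.
Qed.

Lemma sum_inv_pow2 K : \sum_(s <- iota 0 K) ((2 ^ s)%:R)^-1 <= 2 :> R.
Proof.
suff -> : \sum_(s <- iota 0 K) ((2 ^ s)%:R)^-1 = 2 - 2 / (2 ^ K)%:R :> R.
  by rewrite gerBl divr_ge0.
elim: K => [|K IH]; first by rewrite big_nil divr1 subrr.
rewrite -addn1 iotaD big_cat /= big_cons big_nil IH add0n addr0 addn1 expnS natrM.
have : (2 ^ K)%:R != 0 :> R by rewrite pnatr_eq0 -lt0n expn_gt0.
by move=> h; field; rewrite h.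
Qed.

(** The main terms form a geometric series in the block length, so the number of lengths, about
    [log K], does not enter the main term. *)
Lemma bad_block_count y z K N : (K <= y)%N -> 1 <= recip_primes R y z ->
  \sum_(1 <= m < N.+1) (bad_block y z K m)%:R
    <= 64 * (2 * N%:R / recip_primes R y z + 4 * K%:R * z%:R ^+ 2) :> R.
Proof.
move=> Ky L1; set L := recip_primes R y z in L1 *.
have L0 : 0 < L by apply: lt_le_trans L1.
apply: le_trans (_ : \sum_(1 <= m < N.+1) \sum_(st <- blocks K)
  (~~ has (shift_divides^~ m) (prime_shifts y z (st.2 * 2 ^ st.1) (2 ^ st.1)))%:R <= _).
  by apply: ler_sum => m _; apply: has_le_sum.
rewrite exchange_big big_allpairs /=.
apply: le_trans (_ : \sum_(s <- iota 0 K | (2 ^ s <= K)%N) \sum_(t <- iota 0 64) (N%:R / ((2 ^ s)%:R * L) + 4 * z%:R ^+ 2) <= _).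
  rewrite big_filter; apply: ler_sum => s sK; apply: ler_sum => t _.
  by apply: block_count; rewrite ?expn_gt0 // (leq_trans sK).
under eq_bigr do rewrite big_const_seq count_predT size_iota iter_addr_0 -[_ *+ 64]mulr_natl.
rewrite -mulr_sumr ler_pM2l //.
apply: le_trans (_ : \sum_(s <- iota 0 K) (N%:R / ((2 ^ s)%:R * L) + 4 * z%:R ^+ 2) <= _).
  rewrite big_mkcond; apply: ler_sum => s _; case: ifP => // _.
  by rewrite addr_ge0 // ?divr_ge0 ?mulr_ge0 // ltW.
rewrite big_split /=; apply: lerD.
  have -> : \sum_(s <- iota 0 K) N%:R / ((2 ^ s)%:R * L) =
      N%:R / L * \sum_(s <- iota 0 K) ((2 ^ s)%:R)^-1.
    by rewrite mulr_sumr; apply: eq_bigr => s _; rewrite invfM mulrA mulrAC.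
  rewrite [2 * _]mulrC [leRHS]mulrAC ler_wpM2l ?divr_ge0 ?(ltW L0) //.
  exact: sum_inv_pow2.
rewrite big_const_seq count_predT size_iota iter_addr_0.
by rewrite -[_ *+ K]mulr_natl mulrA [K%:R * 4]mulrC.
Qed.

End Bad.

Lemma large_exact_prime_of_shift y z K m u k : (64 * K < m)%N -> (k <= y)%N ->
  (u.2 < 64 * K)%N -> u \in prime_shifts y z 0 (64 * K) -> shift_divides u m ->
  ~~ shift_divides2 u m -> large_exact_prime k m u.2.
Proof.
move=> Km ky uK /prime_shiftsP[pr /andP[yp _] _].
have um : u.2 <= m by apply: ltnW; apply: ltn_trans Km.
have mu0 : 0 < m - u.2 by rewrite subn_gt0 (ltn_trans uK).
rewrite /shift_divides /shift_divides2 !eqn_mod_dvd // => d1 d2.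
exists u.1; split=> //; first exact: leq_ltn_trans yp.
apply/eqP; rewrite eqn_leq -[X in _ && (X <= _)]/1 -(pfactor_dvdn 1) // expn1 d1 andbT.
by rewrite leqNgt -pfactor_dvdn.
Qed.

Lemma good_of_not_bad K m z (y := K ^ 2) : 64 <= K -> 64 * K < m ->
  ~~ bad_square y z K m -> ~~ bad_block y z K m -> good_m K m.
Proof.
move=> K64 Km /hasPn nosq /hasPn nobl.
have Ky : K <= y by rewrite /y -mulnn leq_pmulr // (leq_trans _ K64).
have block s t k : 2 ^ s <= K -> t < 64 -> k <= K ->
    exists i, t * 2 ^ s <= i < t * 2 ^ s + 2 ^ s /\ large_exact_prime k m i.
  move=> sK t64 kK.
  have /nobl /= : (s, t) \in blocks K.
    apply: (allpairs_f pair); last by rewrite mem_iota.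
    by rewrite mem_filter mem_iota sK /= add0n (leq_trans _ sK) // ltn_expl.
  move=> /negPn/hasP[u uJ du]; have /prime_shiftsP[pr yz ib] := uJ.
  have uK : u.2 < 64 * K.
    move/andP: ib => [_ ib]; apply: (leq_trans ib).
    rewrite -[X in _ + X]mul1n -mulnDl addn1; exact: leq_mul.
  have uJ2 : u \in prime_shifts y z 0 (64 * K).
    by apply/prime_shiftsP; split=> //; rewrite add0n uK.
  exists u.2; split=> //; apply: (large_exact_prime_of_shift (y := y) (z := z) (K := K)) => //.
    exact: leq_trans Ky.
  exact: nosq.
have good_i k t : t < 64 -> k <= K -> large_exact_prime k m t.
  move=> t64 kK; have [||//|i [ib +]] := block 0 t k; first by rewrite expn0 (leq_trans _ K64).
    by [].
  by move: ib; rewrite expn0 muln1 addn1 ltnS -eqn_leq => /eqP ->.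
move=> k /andP[k8 kK].
have km : k <= m by apply: leq_trans kK _; apply: leq_trans (ltnW Km); apply: leq_pmull.
split=> //.
(* Up to 65 the shift [k - 2] is below 64, hence forms a block of length 1. *)
have [k65|k66] := leqP k 65.
  apply: (@trexp_full_symmetric m k 2) => //; try by [apply: good_i | lia].
  by apply: good_i => //; lia.
(* All shifts [i] of the block [(s, t)] chosen below satisfy [8 * (k - i) <= k]. *)
pose s := trunc_log 2 (k %/ 32).
have k32 : 0 < k %/ 32 by rewrite divn_gt0 // (leq_trans _ k66).
have /andP[s1 s2] := trunc_log_bounds (isT : 1 < 2) k32.
rewrite -/s in s1 s2; set w := 2 ^ s in s1.
have w0 : 0 < w by rewrite expn_gt0.
(* From [32 * w <= k < 64 * w]: the first inequality makes blocks of length [w] short compared with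
   [k], the second keeps the index below 64. *)
have kw1 : 32 * w <= k.
  by rewrite mulnC; apply: leq_trans (leq_trunc_div k 32); rewrite leq_mul2r s1 orbT.
have kw2 : k < 64 * w.
  have := ltn_ceil k (isT : 0 < 32); move: s2; rewrite expnS -/w; clear; lia.
(* The block of [k - 2] itself might contain [k - 1] or reach beyond the degree. The preceding block
   lies below [k - 2], and its shifts satisfy [k - i <= 2 * w + 1]. *)
pose t := ((k - 2) %/ w).-1.
have tw1 : (k - 2) %/ w * w <= k - 2 by apply: leq_trunc_div.
have tw2 : k - 2 < ((k - 2) %/ w).+1 * w by apply: ltn_ceil.
have t0 : 0 < (k - 2) %/ w by rewrite divn_gt0 //; move: kw1 w0 k66; clear; lia.
have t64 : (k - 2) %/ w < 64.
  by rewrite ltn_divLR //; move: kw2; clear; lia.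
have [||i [ib gi]] := block s t k _ _ kK.
- by move: kw1 kK; clear; rewrite -/w; lia.
- by rewrite /t; move: t64; clear; lia.
rewrite -/w in ib.
have ib1 : i < k - 2.
  apply: leq_trans tw1; move: ib; rewrite /t; case: ((k - 2) %/ w) t0 => // q _ /=.
  by rewrite mulSn addnC => /andP[].
have ib2 : k - 2 < i + 2 * w.
  apply: leq_trans tw2 _; move: ib; rewrite /t; case: ((k - 2) %/ w) t0 => // q _ /=.
  by rewrite !mulSn => /andP[h _]; move: h; clear; lia.
apply: (@trexp_full_symmetric m k (k - i)) => //; try by [apply: good_i | lia].
by rewrite subKn //; move: ib1; clear; lia.
Qed.

(** * Collecting the error terms and passing to the limit *)

Section Limit.
Local Open Scope ring_scope.
Variable R : realType.

(** With [z ^ 4 <= N] every error term is a multiple of [N / K]: small [m] give 64, squares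
    [64 * 2], blocks [64 * 4], in total 448. The main term of the blocks is [64 * 2 * N / L] with
    [L >= T / 8], whence 1024; [T >= 8] ensures [L >= 1]. *)
Lemma count_bad K T N : (64 <= K)%N -> (8 <= T)%N -> (K ^ (8 * 8 ^ T) <= N)%N ->
  (count (fun m => ~~ `[< good_m K m >]) (iota 1 N))%:R
    <= N%:R * (448 / K%:R + 1024 / T%:R) :> R.
Proof.
move=> K64 T8 KN; pose y := (K ^ 2)%N; pose z := (y ^ (8 ^ T))%N.
have K0 : (0 < K)%N by apply: leq_trans K64.
have zN : (z ^ 4 <= N)%N.
  by apply: leq_trans KN; rewrite /z /y -!expnM; apply: eq_leq; congr (_ ^ _)%N; lia.
have y3 : (3 <= y)%N by rewrite /y -mulnn; nia.
have Ky : (K <= y)%N by rewrite /y -mulnn leq_pmulr.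
have y0 : (0 < y)%N by apply: leq_trans y3.
have yz : (y <= z)%N by rewrite /z -[X in (X <= _)%N]expn1 leq_pexp2l // expn_gt0.
have L8 := recip_primes_lb R T y3; rewrite -/z in L8.
set L := recip_primes R y z in L8.
have T8' : 8 <= T%:R :> R by rewrite ler_nat.
have L1 : 1 <= L by apply: le_trans L8; rewrite ler_pdivlMr // mul1r.
have K0' : 0 < K%:R :> R by rewrite ltr0n.
have T0' : 0 < T%:R :> R by apply: lt_le_trans T8'.
have L0 : 0 < L by apply: lt_le_trans L1.
have -> : (count (fun m => ~~ `[< good_m K m >]) (iota 1 N))%:R =
    \sum_(1 <= m < N.+1) (~~ `[< good_m K m >])%:R :> R.
  by rewrite -natr_sum /index_iota subSS subn0 -sumn_count sumnE big_map.
apply: le_trans (_ : \sum_(1 <= m < N.+1) ((m <= 64 * K)%N%:R +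
    ((bad_square y z K m)%:R + (bad_block y z K m)%:R)) <= _).
  apply: ler_sum => m _; rewrite -!natrD ler_nat.
  case: (asboolP (good_m K m)) => //= bad.
  have [//|mK] := leqP m (64 * K); case bs: (bad_square _ _ _ _) => //.
  case bb: (bad_block _ _ _ _) => //; case: bad.
  by apply: (@good_of_not_bad K m z); rewrite ?bs ?bb.
rewrite !big_split /=.
have h1 : \sum_(1 <= m < N.+1) (m <= 64 * K)%N%:R <= (64 * K)%:R :> R.
  rewrite -natr_sum ler_nat.
  have -> : (\sum_(1 <= m < N.+1) (m <= 64 * K) = minn N (64 * K))%N.
    elim: N {KN zN} => [|n IH]; first by rewrite big_geq // min0n.
    by rewrite big_nat_recr //= IH; case: leqP; lia.
  exact: geq_minr.
have h2 := bad_square_count R z K N y0.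
have h3 := @bad_block_count R y z K N Ky L1; rewrite -/L in h3.
have e1 : K%:R ^+ 2 <= N%:R :> R.
  rewrite -natrX ler_nat; apply: leq_trans zN.
  by apply: leq_trans yz _; rewrite -[X in (X <= _)%N]expn1 leq_pexp2l ?expn_gt0 ?K0.
have z0 : (0 < z)%N by rewrite !expn_gt0 K0.
have Kz : (K <= z)%N by apply: leq_trans yz.
have e2 : K%:R * z%:R <= N%:R / K%:R :> R.
  rewrite ler_pdivlMr // -!natrM ler_nat; apply: leq_trans zN.
  by rewrite (expnD z 2 2) mulnAC; apply: leq_mul; [rewrite mulnn leq_sqr|rewrite -[X in (X <= _)%N]expn1 leq_pexp2l].
have e3 : K%:R * z%:R ^+ 2 <= N%:R / K%:R :> R.
  rewrite ler_pdivlMr // -natrX -!natrM ler_nat; apply: leq_trans zN.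
  by rewrite (expnD z 2 2) mulnAC; apply: leq_mul => //; rewrite mulnn leq_sqr.
have e4 : K%:R <= N%:R / K%:R :> R by rewrite ler_pdivlMr // -expr2.
have e5 : 2 * N%:R / L <= 16 * N%:R / T%:R.
  rewrite ler_pdivrMr // mulrAC ler_pdivlMr //.
  have : N%:R * (T%:R / 8) <= N%:R * L by rewrite ler_wpM2l.
  lra.
have e6 : K%:R * (N%:R / y%:R) = N%:R / K%:R :> R.
  by rewrite /y natrX; field; rewrite gt_eqF.
move: h2; rewrite mulrDr -!mulrA e6 => h2.
move: h1; rewrite natrM => h1.
have -> : N%:R * (448 / K%:R + 1024 / T%:R) = 448 * (N%:R / K%:R) + 64 * (16 * N%:R / T%:R) :> R by lra.
lra.
Qed.
End Limit.

Local Open Scope classical_set_scope.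
Local Open Scope ring_scope.

Theorem theorem1 (R : realType) (kmax : R -> nat)
  (kpos : forall x : R, (0 < kmax x)%N)
  (ko1 : ln (kmax x)%:R / ln x @[x --> +oo] --> (0 : R)) :
  prob_good (kmax x) x @[x --> +oo] --> (1 : R).
Proof.
apply/cvgrPdist_le => e e0.
have e2 : 0 < e / 2 by rewrite divr_gt0.
have bound (c : R) : 0 < c -> exists n : nat, (64 <= n)%N /\ c / n%:R <= e / 2.
  move=> c0; exists (64 + Num.truncn (c / (e / 2))).+1; split.
    by rewrite -addSn leqW // leq_addr.
  rewrite ler_pdivrMr ?ltr0n // mulrC -ler_pdivrMr //.
  apply: le_trans (ltW (truncnS_gt _)) _.
  by rewrite ler_nat ltnS leq_addl.
(* [T] depends on [e] alone, so the exponent [E] is a constant when the hypothesis on [kmax] is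
   applied with tolerance [1 / E]. *)
have [T [T64 Te]] : exists n : nat, (64 <= n)%N /\ 1024 / n%:R <= e / 2.
  by apply: bound; rewrite ltr0n.
have [K1 [K64 K1e]] : exists n : nat, (64 <= n)%N /\ 448 / n%:R <= e / 2.
  by apply: bound; rewrite ltr0n.
set E := (8 * 8 ^ T)%N.
have E0 : 0 < E%:R :> R by rewrite ltr0n muln_gt0 expn_gt0.
have Einv : 0 < E%:R^-1 :> R by rewrite invr_gt0.
have K10 : (0 < K1)%N by apply: leq_trans K64.
move/cvgrPdist_le : ko1 => /(_ _ Einv) ko1.
near=> x.
have x1 : 1 < x by near: x; apply: nbhs_pinfty_gt; rewrite num_real.
have xK1 : (K1 ^ E)%:R <= x by near: x; apply: nbhs_pinfty_ge; rewrite num_real.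
have kx : `|0 - ln (kmax x)%:R / ln x| <= E%:R^-1 by near: x.
have x0 : 0 < x by apply: lt_trans x1.
have lx : 0 < ln x by apply: ln_gt0.
have kE : (kmax x ^ E)%:R <= x.
  have k0 : 0 < (kmax x)%:R :> R by rewrite ltr0n.
  rewrite natrX -ler_ln ?posrE ?exprn_gt0 // lnXn // -[_ *+ E]mulr_natl.
  move: kx; rewrite sub0r normrN => /(le_trans (ler_norm _)).
  by rewrite ler_pdivrMr // ler_pdivlMl.
(* [kmax] may stay bounded while [448 / K] has to be small; enlarging [K] only strengthens
   [good_m]. *)
set N := Num.truncn x; set K := maxn (kmax x) K1.
have NE n : (n%:R <= x) = (n <= N)%N by rewrite truncn_ge_nat // ltW.
have KN : (K ^ E <= N)%N by rewrite /K /maxn; case: ifP => _; rewrite -NE.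
have K64' : (64 <= K)%N by rewrite (leq_trans K64) // leq_maxr.
have T8 : (8 <= T)%N by apply: leq_trans T64.
have N0 : 0 < N%:R :> R.
  by rewrite ltr0n (leq_trans _ KN) // expn_gt0 (leq_trans _ K64').
have := count_bad R K64' T8 KN.
have good_le : (count (fun m => ~~ `[< good_m (kmax x) m >]) (iota 1 N) <=
    count (fun m => ~~ `[< good_m K m >]) (iota 1 N))%N.
  apply: sub_count => m; apply: contra => /asboolP gK; apply/asboolP => k /andP[k8 kk].
  by apply: gK; rewrite k8 (leq_trans kk) // leq_maxl.
have : (count (fun m => ~~ `[< good_m (kmax x) m >]) (iota 1 N))%:R <=
    (count (fun m => ~~ `[< good_m K m >]) (iota 1 N))%:R :> R by rewrite ler_nat.
move=> /le_trans h /h {h}.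
rewrite /prob_good -/N; set g := count (fun m => `[< good_m (kmax x) m >]) _.
have /(congr1 (fun n => n%:R : R)) := count_predC (fun m => `[< good_m (kmax x) m >]) (iota 1 N).
rewrite size_iota natrD -/g; set b : R := (count _ _)%:R => gb.
rewrite -/b => bN; have -> : 1 - g%:R / N%:R = b / N%:R.
  have -> : b = N%:R - g%:R by rewrite -gb [g%:R + b]addrC addrK.
  by rewrite mulrBl divff // lt0r_neq0.
rewrite ger0_norm ?divr_ge0 // ler_pdivrMr // mulrC; apply: le_trans bN _.
rewrite ler_pM2l // [leRHS]splitr lerD //; apply: le_trans K1e.
rewrite ler_pM2l ?ltr0n // lef_pV2 ?posrE ?ltr0n // ?(leq_trans _ K64') //.
by rewrite ler_nat leq_maxr.
Unshelve. all: by end_near.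
Qed.
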